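(* Let $w$ be a word of length $n$ over an integer alphabet $\{1,\ldots,n^{\mathcal{O}(1)}\}$. For every $r \in \{1,\ldots,n\}$ there is a data structure of size $\mathcal{O}(n^2/r)$ that can be constructed in $\mathcal{O}(n^2/r)$ time and answers antipower queries in $\mathcal{O}(r)$ time.
   Context: Letters of a word $w$ are numbered $0,\ldots,|w|-1$ and $w[i\mathinner{.\,.} j]$ denotes the fragment (factor occurrence) $w[i]w[i+1]\cdots w[j]$. A word $x$ is a $k$-antipower (for $k\ge 2$) if $x=y_0y_1\cdots y_{k-1}$ where $y_0,\ldots,y_{k-1}$ are words of the same length that are pairwise distinct. An antipower query $(i,j,k)$ asks whether the fragment $w[i\mathinner{.\,.} j]$ is a $k$-antipower. *)

(* Defs.v *)
(* Words are sequences of natural numbers (MathComp).  Complexity bounds refer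
   to a unit-cost word RAM, with programs given in structured form
   (assignments, stores, conditionals, while loops). *)
From mathcomp Require Import all_boot.

Set Implicit Arguments.
Unset Strict Implicit.
Unset Printing Implicit Defensive.

(* w[i .. j], both ends included. *)
Definition fragment (T : Type) (w : seq T) (i j : nat) : seq T :=
  take (j.+1 - i) (drop i w).

Definition antipower (T : eqType) (k : nat) (x : seq T) : Prop :=
  2 <= k /\
  exists ys : seq (seq T),
    [/\ size ys = k,
        x = flatten ys,
        (exists d, forall y, y \in ys -> size y = d) &
        uniq ys].

Inductive binop : Type :=
  | OpAdd | OpSub | OpMul | OpDiv | OpMod | OpLt | OpEq | OpAnd | OpOr | OpXor | OpShl | OpShr.

(* [Reg x] is register x; a program mentions finitely many registers.
   [Cell e] is the memory cell whose address is the value of e. *)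
Inductive expr : Type :=
  | Const of nat
  | Reg of nat
  | Cell of expr
  | Bin of binop & expr & expr.

Inductive cmd : Type :=
  | Skip
  | Set_reg of nat & expr
  | Store of expr & expr
  | Seq of cmd & cmd
  | If of expr & cmd & cmd
  | While of expr & cmd.

Record state : Type := State { regs : nat -> nat; mem : seq nat }.

(* Arithmetic on W-bit words, modulo 2 ^ W.  Division and remainder by zero
   have the values of %/ and %% (0 and the dividend). *)
Definition eval_op (W : nat) (o : binop) (x y : nat) : nat :=
  match o with
  | OpAdd => x + y
  | OpSub => x + (2 ^ W - y %% 2 ^ W)
  | OpMul => x * y
  | OpDiv => x %/ y
  | OpMod => x %% y
  | OpLt  => x < y
  | OpEq  => x == y
  | OpAnd => Nat.land x y
  | OpOr  => Nat.lor x y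
  | OpXor => Nat.lxor x y
  | OpShl => x * 2 ^ y
  | OpShr => x %/ 2 ^ y
  end %% 2 ^ W.

(* [None] is a fault: the memory consists of the cells 0, .., size (mem s) - 1
   only, and no other address may be accessed. *)
Fixpoint eval (W : nat) (s : state) (e : expr) : option nat :=
  match e with
  | Const a => Some (a %% 2 ^ W)
  | Reg x => Some (regs s x)
  | Cell e1 =>
      if eval W s e1 is Some a then
        if a < size (mem s) then Some (nth 0 (mem s) a) else None
      else None
  | Bin o e1 e2 =>
      if (eval W s e1, eval W s e2) is (Some x, Some y)
      then Some (eval_op W o x y) else None
  end.

Fixpoint expr_cost (e : expr) : nat :=
  match e with
  | Const _ | Reg _ => 1
  | Cell e1 => (expr_cost e1).+1
  | Bin _ e1 e2 => (expr_cost e1 + expr_cost e2).+1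
  end.

(* [exec W c s t s']: on W-bit words, program c started in state s halts
   without fault in state s' after t steps.  Nonzero means true. *)
Inductive exec (W : nat) : cmd -> state -> nat -> state -> Prop :=
  | ExecSkip s : exec W Skip s 1 s
  | ExecSet s x e v :
      eval W s e = Some v ->
      exec W (Set_reg x e) s (expr_cost e).+1
        (State [eta regs s with x |-> v] (mem s))
  | ExecStore s e1 e2 a v :
      eval W s e1 = Some a -> eval W s e2 = Some v -> a < size (mem s) ->
      exec W (Store e1 e2) s (expr_cost e1 + expr_cost e2).+1
        (State (regs s) (set_nth 0 (mem s) a v))
  | ExecSeq c1 c2 s s1 s2 t1 t2 :
      exec W c1 s t1 s1 -> exec W c2 s1 t2 s2 ->
      exec W (Seq c1 c2) s (t1 + t2) s2
  | ExecIf e c1 c2 s s1 v t :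
      eval W s e = Some v ->
      exec W (if v != 0 then c1 else c2) s t s1 ->
      exec W (If e c1 c2) s (expr_cost e + t).+1 s1
  | ExecWhileFalse e c s :
      eval W s e = Some 0 ->
      exec W (While e c) s (expr_cost e).+1 s
  | ExecWhileTrue e c s s1 s2 v t1 t2 :
      eval W s e = Some v -> v != 0 ->
      exec W c s t1 s1 -> exec W (While e c) s1 t2 s2 ->
      exec W (While e c) s (expr_cost e + t1 + t2).+1 s2.

(* Inputs are passed in registers 0, 1, ..; all other registers hold 0. *)
Definition start (args m : seq nat) : state := State (nth 0 args) m.

Definition antipower_query : Type := (nat * nat * nat)%type.

(* Any i <= j < n and any k >= 2 that fits into a machine word. *)
Definition valid_query (W n : nat) (q : antipower_query) : bool :=
  let: (i, j, k) := q in [&& i <= j, j < n & 2 <= k < 2 ^ W].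

(* Starting with memory m, the queries qs, asked one after the other, are
   answered correctly by program c in at most T steps each.  Only the memory
   survives from one query to the next; the answer is "yes" iff register 0 is
   nonzero on halting. *)
Fixpoint answers (W T : nat) (c : cmd) (w m : seq nat) (qs : seq antipower_query) :
    Prop :=
  if qs is (i, j, k) :: qs' then
    exists (s : state) (t : nat),
      [/\ exec W c (start [:: i; j; k] m) t s,
          t <= T,
          regs s 0 <> 0 <-> antipower k (fragment w i j) &
          answers W T c w (mem s) qs']
  else True.

(* A memory of M cells suffices for both programs: [build], given the length
   of w and r in registers and w in the first cells of a memory that is zero
   elsewhere, turns it within [Tbuild] steps into a data structure from which
   [query] answers every sequence of antipower queries on w, each within
   [Tquery] steps. *)
Definition antipower_data_structure (W : nat) (build query : cmd)
    (w : seq nat) (r M Tbuild Tquery : nat) : Prop :=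
  size w <= M /\
  exists (s : state) (t : nat),
    [/\ exec W build (start [:: size w; r] (w ++ nseq (M - size w) 0)) t s,
        t <= Tbuild &
        forall qs, all (valid_query W (size w)) qs ->
          answers W Tquery query w (mem s) qs].

(* Main.v *)
(* Put s = n / r.  The basic operation is refinement: given a class and a letter
   at each of N positions, rename the positions in O(N) time so that two of them
   share a name iff they agree on both.  Applied s times, it names all factors of
   length 1, .., s in O(n s) = O(n^2 / r) time.  For block length d <= s we store
   at each i the first position ending a repetition among the length-d blocks
   i, i + d, i + 2d, ..: a query compares the start of its last block with that
   entry.  If d > s then k d <= n forces k < r, and each block is covered by
   ceil(d / s) windows of length s whose names are stored; refining the k blocks
   window by window takes O(k d / s + k) = O(r) time. *)
Require Import Defs.
From mathcomp Require Import all_boot zify.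
(* [all_boot] shadows the projection [mem] of [state]. *)
Import Defs.

Set Implicit Arguments.
Unset Strict Implicit.
Unset Printing Implicit Defensive.

(** * Running time bounds *)

(** The O(N) bound for refinement must also hold when N is the number k of blocks of a single query,
    although the letters are then names ranging over positions of the whole word. No bucket array
    can be cleared beforehand in that time. So [refine] restores the zeros of row HD while it
    consumes the lists, and an entry of row ST is verified at each use instead of being initialised.
    Names are positions representing their classes: they stay below N, index rows themselves and
    need no counter.

    Restoring HD also makes queries composable. Only memory survives a query, and of the scratch
    rows the invariant [structure] constrains HD alone.

    The tables of repetitions are filled from right to left: the entry at i comes from the entry at
    i + d and the nearest later position with the name of i. Names must separate residues modulo d
    there, so that this nearest position lies in the progression of i.

    The query bound rests on n < (s + 1) r, which for s >= 1 gives n <= 2 s r. *)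

Definition upd (s : state) (x v : nat) : state :=
  State [eta regs s with x |-> v] (mem s).

Definition sto (s : state) (m : seq nat) : state := State (regs s) m.

(** Time is an upper bound, so that branches of unequal cost and loops that stop early share one
    figure. *)
Definition runs (W : nat) (c : cmd) (s : state) (T : nat) (Q : state -> Prop) : Prop :=
  exists s' t, [/\ exec W c s t s', t <= T & Q s'].

Fixpoint assigned (c : cmd) : seq nat :=
  match c with
  | Set_reg x _ => [:: x]
  | Seq c1 c2 | If _ c1 c2 => assigned c1 ++ assigned c2
  | While _ c1 => assigned c1
  | _ => [::]
  end.

Lemma exec_frame W c s t s' : exec W c s t s' ->
  size (mem s') = size (mem s) /\
  forall x, x \notin assigned c -> regs s' x = regs s x.
Proof.
elim=> {c s t s'} //=.
- by move=> s x e v _; split=> // y; rewrite inE; case: eqP.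
- move=> s e1 e2 a v _ _ lt_a; split=> //.
  by rewrite size_set_nth; apply/maxn_idPr.
- move=> c1 c2 s s1 s2 t1 t2 _ [sz1 fr1] _ [sz2 fr2]; split; first by rewrite sz2.
  by move=> x; rewrite mem_cat negb_or => /andP[/fr1 <- /fr2].
- move=> e c1 c2 s s1 v t _ _ [sz fr]; split=> // x.
  by rewrite mem_cat negb_or => /andP[x1 x2]; apply: fr; case: ifP.
- move=> e c s s1 s2 v t1 t2 _ _ _ [sz1 fr1] _ [sz2 fr2]; split; first by rewrite sz2.
  by move=> x xc; rewrite fr2 // fr1.
Qed.

(** Supplies the frame conditions syntactically, so that specifications and invariants mention only
    what a program changes. *)
Lemma runs_frame W c s T (Q : state -> Prop) : runs W c s T Q ->
  runs W c s T (fun s' => [/\ size (mem s') = size (mem s),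
    forall x, x \notin assigned c -> regs s' x = regs s x & Q s']).
Proof.
by case=> s' [t [ex tT q]]; exists s', t; split=> //; case: (exec_frame ex).
Qed.

Lemma runs_weaken W c s T T' (Q Q' : state -> Prop) :
  runs W c s T Q -> T <= T' -> (forall s', Q s' -> Q' s') -> runs W c s T' Q'.
Proof.
case=> s' [t [ex tT q]] TT' QQ'; exists s', t.
by split=> //; [apply: leq_trans TT' | apply: QQ'].
Qed.

Lemma runs_seq W c1 c2 s T1 T2 (P Q : state -> Prop) :
  runs W c1 s T1 P -> (forall s1, P s1 -> runs W c2 s1 T2 Q) ->
  runs W (Seq c1 c2) s (T1 + T2) Q.
Proof.
case=> s1 [t1 [ex1 tT1 p]] /(_ _ p) [s2 [t2 [ex2 tT2 q]]].
exists s2, (t1 + t2); split=> //; last exact: leq_add.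
exact: ExecSeq ex1 ex2.
Qed.

Lemma runs_if W e c1 c2 s v T (Q : state -> Prop) :
  eval W s e = Some v -> runs W (if v != 0 then c1 else c2) s T Q ->
  runs W (If e c1 c2) s (expr_cost e + T).+1 Q.
Proof.
move=> ev [s' [t [ex tT q]]]; exists s', (expr_cost e + t).+1.
by split=> //; [apply: ExecIf ev ex | rewrite ltnS leq_add2l].
Qed.

(* [I m] is the invariant when at most [m] iterations remain. *)
Lemma runs_while W e c K (I : nat -> state -> Prop) m s :
  (forall m s, I m s -> exists2 v, eval W s e = Some v &
     v != 0 -> exists2 m', m = m'.+1 & runs W c s K (I m')) ->
  I m s ->
  runs W (While e c) s (m * (K + expr_cost e).+1 + (expr_cost e).+1)
    (fun s' => (exists m', I m' s') /\ eval W s' e = Some 0).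
Proof.
move=> step; elim: m s => [|m IH] s Is; have [v ev vP] := step _ _ Is.
  have v0 : v = 0 by apply: contraTeq isT => /vP [].
  exists s, (expr_cost e).+1; split; [by apply: ExecWhileFalse; rewrite ev v0|by []|].
  by split; [exists 0 | rewrite ev v0].
have [v0|vN0] := eqVneq v 0.
  exists s, (expr_cost e).+1; split; [by apply: ExecWhileFalse; rewrite ev v0|lia|].
  by split; [exists m.+1 | rewrite ev v0].
have [m' [<-] [s1 [t1 [ex1 tT1 Is1]]]] := vP vN0.
have [s2 [t2 [ex2 tT2 Q2]]] := IH _ Is1.
exists s2, (expr_cost e + t1 + t2).+1; split=> //; last by rewrite mulSn; lia.
exact: ExecWhileTrue ev vN0 ex1 ex2.
Qed.

(** * Weakest preconditions of loop-free code *)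

Fixpoint wp (W : nat) (c : cmd) (Q : state -> Prop) (s : state) : Prop :=
  match c with
  | Skip => Q s
  | Set_reg x e => exists2 v, eval W s e = Some v & Q (upd s x v)
  | Store e1 e2 => exists2 a, eval W s e1 = Some a &
      exists2 v, eval W s e2 = Some v &
        a < size (mem s) /\ Q (sto s (set_nth 0 (mem s) a v))
  | Seq c1 c2 => wp W c1 (wp W c2 Q) s
  | If e c1 c2 => exists2 v, eval W s e = Some v &
      if v != 0 then wp W c1 Q s else wp W c2 Q s
  | While _ _ => False
  end.

(* Bounds the running time of loop-free code only: [wp] is false on loops. *)
Fixpoint cmd_cost (c : cmd) : nat :=
  match c with
  | Skip => 1
  | Set_reg _ e => (expr_cost e).+1
  | Store e1 e2 => (expr_cost e1 + expr_cost e2).+1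
  | Seq c1 c2 => cmd_cost c1 + cmd_cost c2
  | If e c1 c2 => (expr_cost e + (cmd_cost c1 + cmd_cost c2)).+1
  | While _ _ => 0
  end.

Lemma wp_runs W c s Q : wp W c Q s -> runs W c s (cmd_cost c) Q.
Proof.
elim: c Q s => [|x e|e1 e2|c1 IH1 c2 IH2|e c1 IH1 c2 IH2|//] Q s /=.
- by move=> Qs; exists s, 1; split=> //; apply: ExecSkip.
- by case=> v ev Qs; exists (upd s x v), (expr_cost e).+1; split=> //; apply: ExecSet.
- case=> a ea [v ev [lt_a Qs]].
  by exists (sto s (set_nth 0 (mem s) a v)), (expr_cost e1 + expr_cost e2).+1;
     split=> //; apply: ExecStore.
- by move/IH1 => h1; apply: runs_seq h1 _ => s1; apply: IH2.
- case=> v ev Qs; apply: runs_if ev _.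
  by case: ifP Qs => _ => [/IH1|/IH2] h; apply: runs_weaken h _ _ => //; lia.
Qed.

Lemma wp_mono W c (P P' : state -> Prop) s :
  wp W c P s -> (forall s', P s' -> P' s') -> wp W c P' s.
Proof.
move=> + PP'.
elim: c P P' PP' s => [|x e|e1 e2|c1 IH1 c2 IH2|e c1 IH1 c2 IH2|//] P P' PP' s;
  rewrite /wp -/wp.
- exact: PP'.
- by case=> v ev /PP' h; exists v.
- by case=> a ea [v ev [la /PP' h]]; exists a => //; exists v.
- by apply: IH1 => s'; apply: IH2.
- by case=> v ev h; exists v => //; case: ifP h => _; [apply: IH1 | apply: IH2].
Qed.

Lemma runs_leq W c s T T' (Q : state -> Prop) :
  runs W c s T Q -> T <= T' -> runs W c s T' Q.
Proof. by move=> h TT'; apply: runs_weaken h TT' _. Qed.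

Lemma runs_wp W c s T (Q : state -> Prop) :
  wp W c Q s -> cmd_cost c <= T -> runs W c s T Q.
Proof. by move=> /wp_runs h; apply: runs_leq. Qed.

Lemma runs_wp_seq W c1 c2 s T1 T2 (P Q : state -> Prop) :
  wp W c1 P s -> cmd_cost c1 <= T1 -> (forall s1, P s1 -> runs W c2 s1 T2 Q) ->
  runs W (Seq c1 c2) s (T1 + T2) Q.
Proof. by move=> h1 h2; apply: runs_seq; apply: runs_wp h1 h2. Qed.

(** * Counting loops *)

Definition For (x N : nat) (body : cmd) : cmd :=
  Seq (Set_reg x (Const 0))
    (While (Bin OpLt (Reg x) (Reg N))
       (Seq body (Set_reg x (Bin OpAdd (Reg x) (Const 1))))).

(** The frame relative to the initial state [s] is handed to the body, so [I] need not carry the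
    constant registers. The body establishes [I] at the state in which the counter is already
    advanced. *)
Lemma runs_for W (x N : nat) body K Nv (I : nat -> state -> Prop) s :
  x != N -> x \notin assigned body -> N \notin assigned body ->
  0 < W -> Nv < 2 ^ W -> regs s N = Nv ->
  I 0 (upd s x 0) ->
  (forall u s', u < Nv -> size (mem s') = size (mem s) ->
     (forall y, y \notin x :: assigned body -> regs s' y = regs s y) ->
     regs s' x = u -> I u s' ->
     runs W body s' K (fun s'' => I u.+1 (upd s'' x u.+1))) ->
  runs W (For x N body) s (Nv * (K + 8) + 6)
    (fun s' => [/\ size (mem s') = size (mem s),
      forall y, y \notin x :: assigned body -> regs s' y = regs s y & I Nv s']).
Proof.
move=> xN xb Nb W0 NvW sN I0 step.
have W1 : 1 < 2 ^ W by rewrite -{1}(expn0 2) ltn_exp2l.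
pose J m s' := exists u, [/\ u + m = Nv, size (mem s') = size (mem s),
  forall y, y \notin x :: assigned body -> regs s' y = regs s y,
  regs s' x = u & I u s'].
(* Setting the counter costs 2, each test 4 and each increment 4; the last test fails. *)
have -> : Nv * (K + 8) + 6 = 2 + (Nv * ((K + 4) + 3).+1 + 4) by lia.
apply: (@runs_seq _ _ _ _ _ _ (fun s1 => J Nv s1)).
  have h : wp W (Set_reg x (Const 0)) (fun s1 => J Nv s1) s.
    exists 0; first by rewrite /= mod0n.
    exists 0; split=> //=; last by rewrite eqxx.
    by move=> y; rewrite inE negb_or => /andP[/negbTE ->].
  by have := wp_runs h.
move=> s1 J1; have stepW : forall m s', J m s' ->
  exists2 v, eval W s' (Bin OpLt (Reg x) (Reg N)) = Some v &
    v != 0 -> exists2 m', m = m'.+1 &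
      runs W (Seq body (Set_reg x (Bin OpAdd (Reg x) (Const 1)))) s' (K + 4) (J m').
  move=> m s' [u [um sz fr s'x Iu]].
  have s'N : regs s' N = Nv by rewrite fr // inE negb_or eq_sym xN.
  exists (u < Nv : nat).
    by rewrite /= s'x s'N /eval_op modn_small //; case: (u < Nv); lia.
  case: ltnP => // uN _; exists (Nv - u.+1); first by lia.
  have := runs_frame (step u s' uN sz fr s'x Iu) => h.
  apply: runs_seq h _ => s2 [sz2 fr2 I2].
  have h2 : wp W (Set_reg x (Bin OpAdd (Reg x) (Const 1))) (J (Nv - u.+1)) s2.
    exists u.+1; first by rewrite /= fr2 // s'x /eval_op (modn_small W1) addn1 modn_small //; lia.
    exists u.+1; split=> //=; [by lia|by rewrite sz2|move=> y|by rewrite eqxx].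
    rewrite inE negb_or => /andP[/negbTE yx yb]; rewrite yx fr2 // fr //.
    by rewrite inE negb_or yx.
  by have := wp_runs h2.
have := runs_while stepW J1 => h; apply: runs_weaken h _ _; first by rewrite /=; lia.
move=> s' [[m [u [um sz fr s'x Iu]]] /=].
rewrite s'x fr ?inE ?negb_or 1?eq_sym ?xN // sN /eval_op.
case: ltnP => [|uN _]; first by rewrite modn_small //.
by split=> //; have <- : u = Nv by lia.
Qed.

(** * Two-dimensional memory *)

Notation "e1 +' e2" := (Bin OpAdd e1 e2) (at level 50, left associativity).
Notation "e1 -' e2" := (Bin OpSub e1 e2) (at level 50, left associativity).
Notation "e1 *' e2" := (Bin OpMul e1 e2) (at level 40, left associativity).
Notation "e1 /' e2" := (Bin OpDiv e1 e2) (at level 40, left associativity).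
Notation "e1 %' e2" := (Bin OpMod e1 e2) (at level 40, left associativity).
Notation "e1 <' e2" := (Bin OpLt e1 e2) (at level 70, no associativity).
Notation "e1 ==' e2" := (Bin OpEq e1 e2) (at level 70, no associativity).
Notation "x ::= e" := (Set_reg x e) (at level 80, no associativity).
Notation "c1 ;; c2" := (Seq c1 c2) (at level 85, right associativity).

Notation rB := 3 (only parsing).
Notation rN := 4 (only parsing).
Notation rp := 5 (only parsing).
Notation ra := 6 (only parsing).
Notation rb := 7 (only parsing).
Notation rx := 8 (only parsing).
Notation rc := 9 (only parsing).
Notation rf := 10 (only parsing).
Notation rv := 11 (only parsing).
Notation rn := 12 (only parsing).
Notation rs := 13 (only parsing).
Notation rm := 14 (only parsing).
Notation rt := 15 (only parsing).
Notation rpw := 16 (only parsing).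
Notation rcb := 17 (only parsing).
Notation rd := 18 (only parsing).
Notation ri := 19 (only parsing).
Notation re := 20 (only parsing).
Notation rq := 21 (only parsing).
Notation rl := 22 (only parsing).
Notation rcnt := 23 (only parsing).
Notation ru := 24 (only parsing).
Notation ro := 25 (only parsing).
Notation rbase := 26 (only parsing).

(* Row 0 holds the word, and the pair (n, n %/ r) once the structure is built.
   Row ID names the factors of length n %/ r, and row 7 + d, for
   1 <= d <= n %/ r, holds the first-repetition table of block length d.  In the
   linked lists of rows HD and NX, position p is represented by p + 1 and 0 is
   the empty list; HD is zero except while [refine] runs.  Refinement reads
   classes from CL and letters from LT, and writes the new names to NW. *)
Notation rowW := 0 (only parsing).
Notation rowID := 1 (only parsing).
Notation rowHD := 2 (only parsing).
Notation rowNX := 3 (only parsing).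
Notation rowST := 4 (only parsing).
Notation rowCL := 5 (only parsing).
Notation rowLT := 6 (only parsing).
Notation rowNW := 7 (only parsing).
Notation rowE := (Const 7 +' Reg rd) (only parsing).

Notation scratch := [:: rowHD; rowNX; rowST; rowCL; rowLT; rowNW].

(* Memory is a table of rows of width B = n + 2, and rB holds B. *)
Definition At (q p : expr) : expr := Cell (q *' Reg rB +' p).
Definition PutAt (q p e : expr) : cmd := Store (q *' Reg rB +' p) e.

Definition cell (B : nat) (m : seq nat) (q p : nat) : nat := nth 0 m (q * B + p).
Definition put (B : nat) (m : seq nat) (q p v : nat) : seq nat :=
  set_nth 0 m (q * B + p) v.

(** Columns below B make addresses injective: division by B recovers the row. *)
Lemma cell_put B m q p v q' p' : p < B -> p' < B ->
  cell B (put B m q p v) q' p' =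
  if (q' == q) && (p' == p) then v else cell B m q' p'.
Proof.
move=> pB p'B; rewrite /cell /put nth_set_nth /=.
have -> // : (q' * B + p' == q * B + p) = (q' == q) && (p' == p).
apply/eqP/andP => [e|[/eqP-> /eqP->]] //.
have B0 : 0 < B by lia.
have := congr1 (divn^~ B) e; rewrite /= !divnMDl // !divn_small // !addn0 => qq.
by rewrite qq eqxx; split=> //; apply/eqP; move: e; rewrite qq => /addnI.
Qed.

Lemma upd_eq s x v : regs (upd s x v) x = v.
Proof. by rewrite /= eqxx. Qed.

Lemma upd_ne s x v y : (y == x) = false -> regs (upd s x v) y = regs s y.
Proof. by move=> /= ->. Qed.

Arguments wp : simpl never.

(** * Evaluation of expressions without overflow *)

Section Eval.
Variables (W B Q : nat).

Lemma ev_const s a : a < 2 ^ W -> eval W s (Const a) = Some a.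
Proof. by move=> aW; rewrite /= modn_small. Qed.

Lemma ev_reg s x v : regs s x = v -> eval W s (Reg x) = Some v.
Proof. by move=> /= ->. Qed.

Lemma ev_bin s o e1 e2 x y v : eval W s e1 = Some x -> eval W s e2 = Some y ->
  eval_op W o x y = v -> eval W s (Bin o e1 e2) = Some v.
Proof. by move=> /= -> -> ->. Qed.

Lemma ev_add s e1 e2 x y : eval W s e1 = Some x -> eval W s e2 = Some y ->
  x + y < 2 ^ W -> eval W s (e1 +' e2) = Some (x + y).
Proof. by move=> h1 h2 h; apply: ev_bin h1 h2 _; exact: modn_small. Qed.

Lemma ev_sub s e1 e2 x y : eval W s e1 = Some x -> eval W s e2 = Some y ->
  y <= x -> x < 2 ^ W -> eval W s (e1 -' e2) = Some (x - y).
Proof.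
move=> h1 h2 yx xW; apply: ev_bin h1 h2 _; rewrite /eval_op.
rewrite (modn_small (leq_ltn_trans yx xW)).
have -> : x + (2 ^ W - y) = (x - y) + 2 ^ W by lia.
by rewrite modnDr modn_small //; lia.
Qed.

Lemma ev_mul s e1 e2 x y : eval W s e1 = Some x -> eval W s e2 = Some y ->
  x * y < 2 ^ W -> eval W s (e1 *' e2) = Some (x * y).
Proof. by move=> h1 h2 h; apply: ev_bin h1 h2 _; exact: modn_small. Qed.

Lemma ev_div s e1 e2 x y : eval W s e1 = Some x -> eval W s e2 = Some y ->
  x < 2 ^ W -> eval W s (e1 /' e2) = Some (x %/ y).
Proof.
move=> h1 h2 h; apply: ev_bin h1 h2 _; apply: modn_small.
exact: leq_ltn_trans (leq_div _ _) h.
Qed.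

Lemma ev_mod s e1 e2 x y : eval W s e1 = Some x -> eval W s e2 = Some y ->
  x < 2 ^ W -> eval W s (e1 %' e2) = Some (x %% y).
Proof.
move=> h1 h2 h; apply: ev_bin h1 h2 _; apply: modn_small.
exact: leq_ltn_trans (leq_mod _ _) h.
Qed.

Lemma ev_lt s e1 e2 x y : eval W s e1 = Some x -> eval W s e2 = Some y ->
  1 < 2 ^ W -> eval W s (e1 <' e2) = Some (x < y : nat).
Proof.
by move=> h1 h2 h; apply: ev_bin h1 h2 _; apply: modn_small; case: (x < y); lia.
Qed.

Lemma ev_eq s e1 e2 x y : eval W s e1 = Some x -> eval W s e2 = Some y ->
  1 < 2 ^ W -> eval W s (e1 ==' e2) = Some (x == y : nat).
Proof.
by move=> h1 h2 h; apply: ev_bin h1 h2 _; apply: modn_small; case: (x == y); lia.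
Qed.

Lemma grid_lt q p : q < Q -> p < B -> q * B + p < Q * B.
Proof. by move=> qQ pB; apply: (@leq_trans (q.+1 * B)); [lia|rewrite leq_mul2r qQ orbT]. Qed.

Lemma ev_addr s qe pe q p : regs s rB = B -> Q * B < 2 ^ W ->
  eval W s qe = Some q -> eval W s pe = Some p -> q < Q -> p < B ->
  eval W s (qe *' Reg rB +' pe) = Some (q * B + p).
Proof.
move=> sB QBW hq hp qQ pB; have qpB := grid_lt qQ pB.
by apply: ev_add hp _; [apply: ev_mul hq _ _; [exact: ev_reg|lia]|lia].
Qed.

Lemma eval_cell s e : eval W s (Cell e) =
  if eval W s e is Some a then
    if a < size (mem s) then Some (nth 0 (mem s) a) else None
  else None.
Proof. by []. Qed.

Lemma ev_at s qe pe q p : regs s rB = B -> size (mem s) = Q * B -> Q * B < 2 ^ W ->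
  eval W s qe = Some q -> eval W s pe = Some p -> q < Q -> p < B ->
  eval W s (At qe pe) = Some (cell B (mem s) q p).
Proof.
move=> sB sz QBW hq hp qQ pB; rewrite /At eval_cell (ev_addr sB QBW hq hp qQ pB) sz.
by rewrite grid_lt.
Qed.

Lemma size_put m q p v : size m = Q * B -> q < Q -> p < B ->
  size (put B m q p v) = Q * B.
Proof.
by move=> sz qQ pB; rewrite size_set_nth sz; apply/maxn_idPr; apply: grid_lt.
Qed.

Lemma wp_put s qe pe e q p v (P : state -> Prop) :
  regs s rB = B -> size (mem s) = Q * B -> Q * B < 2 ^ W ->
  eval W s qe = Some q -> eval W s pe = Some p -> q < Q -> p < B ->
  eval W s e = Some v ->
  P (sto s (put B (mem s) q p v)) -> wp W (PutAt qe pe e) P s.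
Proof.
move=> sB sz QBW hq hp qQ pB he Ps; exists (q * B + p); first exact: (@ev_addr s qe pe q p).
by exists v; rewrite // sz grid_lt.
Qed.

Lemma wp_set s x e v (P : state -> Prop) :
  eval W s e = Some v -> P (upd s x v) -> wp W (Set_reg x e) P s.
Proof. by move=> he Ps; exists v. Qed.

Lemma wp_skip s (P : state -> Prop) : P s -> wp W Skip P s.
Proof. by []. Qed.

Lemma wp_seq s c1 c2 (P : state -> Prop) :
  wp W c1 (wp W c2 P) s -> wp W (c1 ;; c2) P s.
Proof. by []. Qed.

Lemma wp_if s e c1 c2 v (P : state -> Prop) :
  eval W s e = Some v ->
  (v <> 0 -> wp W c1 P s) -> (v = 0 -> wp W c2 P s) -> wp W (If e c1 c2) P s.
Proof. by move=> he h1 h2; exists v; rewrite //; case: eqP => /= h; auto. Qed.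

End Eval.

Lemma mem_upd s x v : mem (upd s x v) = mem s. Proof. by []. Qed.
Lemma mem_sto s m : mem (sto s m) = m. Proof. by []. Qed.

(** * Tactics for symbolic execution *)

Ltac rg :=
  lazymatch goal with
  | |- regs (upd _ ?x _) ?y = _ =>
      tryif constr_eq x y then apply: upd_eq
      else (eapply eq_trans; [eapply upd_ne; reflexivity | rg])
  | |- regs (sto ?s _) ?y = ?v => change (regs s y = v); rg
  | |- _ => first [eassumption | reflexivity]
  end.

Ltac sz := repeat (progress rewrite ?mem_upd ?mem_sto);
  first [eassumption | eapply size_put; [sz | lia | lia]].

Ltac cells :=
  repeat (progress rewrite ?mem_upd ?mem_sto);
  repeat (rewrite cell_put; [|lia|lia]); rewrite /=.

Ltac side := try (cells; lia).

Ltac ev :=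
  lazymatch goal with
  | |- eval _ _ (Const _) = _ => apply: ev_const; side
  | |- eval _ _ (Reg _) = _ => apply: ev_reg; rg
  | |- eval _ _ (Bin OpAdd _ _) = _ => eapply ev_add; [ev | ev | side]
  | |- eval _ _ (Bin OpSub _ _) = _ => eapply ev_sub; [ev | ev | side | side]
  | |- eval _ _ (Bin OpMul _ _) = _ => eapply ev_mul; [ev | ev | side]
  | |- eval _ _ (Bin OpDiv _ _) = _ => eapply ev_div; [ev | ev | side]
  | |- eval _ _ (Bin OpMod _ _) = _ => eapply ev_mod; [ev | ev | side]
  | |- eval _ _ (Bin OpLt _ _) = _ => eapply ev_lt; [ev | ev | side]
  | |- eval _ _ (Bin OpEq _ _) = _ => eapply ev_eq; [ev | ev | side]
  | |- eval _ _ (At _ _) = _ => eapply ev_at; [rg | sz | eassumption | ev | ev | side | side]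
  end.

Ltac step :=
  lazymatch goal with
  | |- wp _ (Seq _ _) _ _ => apply: wp_seq; step
  | |- wp _ (Set_reg _ _) _ _ => eapply wp_set; [ev | cbv beta]
  | |- wp _ (PutAt _ _ _) _ _ =>
      eapply wp_put; [rg | sz | eassumption | ev | ev | side | side | ev | cbv beta]
  | |- wp _ (If _ _ _) _ _ => eapply wp_if; [ev | cbv beta | cbv beta]
  | |- wp _ Skip _ _ => apply: wp_skip
  end.

(** * Refinement *)

Definition bucket_letters : cmd :=
  For rp rN
    (rx ::= At (Const rowLT) (Reg rp) ;;
     PutAt (Const rowNX) (Reg rp) (At (Const rowHD) (Reg rx)) ;;
     PutAt (Const rowHD) (Reg rx) (Reg rp +' Const 1)).

(* Row ST is never initialised: its entry for a class is used only if it is a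
   position of that class carrying the letter of the current list. *)
Definition group_step : cmd :=
  rx ::= Reg rb -' Const 1 ;;
  rc ::= At (Const rowCL) (Reg rx) ;;
  rf ::= At (Const rowST) (Reg rc) ;;
  rv ::= Const 0 ;;
  If (Reg rf <' Reg rN)
    (rv ::= (At (Const rowCL) (Reg rf) ==' Reg rc) *'
            (At (Const rowLT) (Reg rf) ==' At (Const rowLT) (Reg rx)))
    Skip ;;
  If (Reg rv) Skip (PutAt (Const rowST) (Reg rc) (Reg rx) ;; rf ::= Reg rx) ;;
  PutAt (Const rowNW) (Reg rx) (Reg rf) ;;
  rb ::= At (Const rowNX) (Reg rx).

Definition enter_bucket : cmd :=
  rx ::= At (Const rowLT) (Reg ra) ;;
  rb ::= At (Const rowHD) (Reg rx) ;;
  PutAt (Const rowHD) (Reg rx) (Const 0) ;;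
  ra ::= Reg ra +' Const 1.

Definition refine : cmd :=
  bucket_letters ;;
  (ra ::= Const 0 ;; rb ::= Const 0) ;;
  While ((Reg ra <' Reg rN) +' Reg rb) (If (Reg rb) group_step enter_bucket).

(** The head of the list of letter [l] after the positions below [u] have been pushed, with p
    represented by p + 1 and 0 for the empty list. At [u = p] and [l = lt p] it is also the link
    stored for p in row NX. *)
Fixpoint last_before (lt : nat -> nat) (l u : nat) : nat :=
  if u is v.+1 then if lt v == l then u else last_before lt l v else 0.

Lemma last_before_le lt l u : last_before lt l u <= u.
Proof. by elim: u => //= u IH; case: ifP => // _; apply: leq_trans IH _. Qed.

Lemma last_beforeP lt l u : last_before lt l u <> 0 -> lt (last_before lt l u).-1 = l.
Proof. by elim: u => //= u IH; case: ifP => // /eqP. Qed.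

Lemma last_before_max lt l u e : e < u -> lt e = l -> e < last_before lt l u.
Proof.
elim: u => //= u IH; case: ifP => // lu; rewrite ltnS leq_eqVlt => /orP[/eqP->|/IH h] //.
by move=> ul; rewrite ul eqxx in lu.
Qed.

(* [(a, b)] is the position of the traversal: the letter lists of positions < a
   have been entered, and the current one is done down to its pointer b. *)
Definition processed (lt : nat -> nat) (a b e : nat) : bool :=
  (last_before lt (lt e) a != 0) && ~~ [&& b != 0, lt e == lt b.-1 & e < b].

(* New names are representatives, hence fixed points of nw. *)
Definition refines (N : nat) (cl lt nw : nat -> nat) : Prop :=
  (forall a, a < N -> [/\ nw a < N, cl (nw a) = cl a & lt (nw a) = lt a]) /\
  (forall a b, a < N -> b < N -> cl a = cl b -> lt a = lt b -> nw a = nw b).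

(** Makes the number of unprocessed positions drop strictly in the termination measure of
    [refine]. *)
Lemma count_lt (P P' : pred nat) (s : seq nat) x :
  {in s, forall y, P' y -> P y} -> x \in s -> P x -> ~~ P' x -> count P' s < count P s.
Proof.
elim: s => //= y s IH sub; rewrite inE => xs Px nP'x.
have le : count P' s <= count P s.
  have -> : count P' s = count (predI P P') s.
    apply: eq_in_count => z zs /=; case E: (P' z); rewrite ?andbF //.
    by rewrite (sub z) // inE zs orbT.
  by apply: sub_count => z /andP[].
have lty : P' y <= P y by case E: (P' y) => //; rewrite (sub y) // inE eqxx.
case/orP: xs => [/eqP xy|xs].
  by rewrite -xy Px (negbTE nP'x) /= add0n add1n ltnS.
have lt := IH (fun z zs => sub z (@mem_behead _ (y :: s) z zs)) xs Px nP'x.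
by rewrite -addnS leq_add.
Qed.

(** Entering a bucket processes nothing: a letter met for the first time has its whole list pending,
    and one met before has a list already consumed, whose head reads 0. *)
Lemma processed_enter lt N a b e : a < N -> e < N ->
  b = (if last_before lt (lt a) a != 0 then 0 else last_before lt (lt a) N) ->
  processed lt a.+1 b e = processed lt a 0 e.
Proof.
move=> aN eN ->; rewrite /processed /= andbT.
case: (eqVneq (lt a) (lt e)) => [ae|nae].
  rewrite /= -ae; case: (eqVneq (last_before lt (lt a) a) 0) => //= h.
  have bN0 : last_before lt (lt a) N <> 0 by have := last_before_max aN (erefl (lt a)); lia.
  have ebN := last_before_max eN (esym ae).
  by rewrite last_beforeP // ebN eqxx; move/eqP: bN0 => ->.
case: ifP => _ /=; first by rewrite andbT.
case: (eqVneq (last_before lt (lt a) N) 0) => [->|/eqP h]; first by rewrite andbT.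
by rewrite (last_beforeP h) [lt e == _]eq_sym (negbTE nae) /= ?andbF ?andbT.
Qed.

(** Lists run through decreasing positions, and no position of the same letter lies between [b.-1]
    and its successor in the list; one move of the pointer thus handles exactly [b.-1]. *)
Lemma processed_group lt a b e : b <> 0 -> last_before lt (lt b.-1) a <> 0 ->
  processed lt a (last_before lt (lt b.-1) b.-1) e = processed lt a b e || (e == b.-1).
Proof.
move=> bN0 seen; rewrite /processed.
case: (eqVneq e b.-1) => [->|ne] /=; rewrite ?orbT ?orbF.
  have := last_before_le lt (lt b.-1) b.-1.
  by move/eqP: seen => -> /=; rewrite ltnNge => ->; rewrite !andbF.
congr (_ && ~~ _); move/eqP: bN0 (bN0) => -> bN0 /=.
set b' := last_before _ _ _.
have [eb|neb] := eqVneq (lt e) (lt b.-1); last first.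
  by case: (eqVneq b' 0) => // /eqP h; rewrite (last_beforeP h) (negbTE neb).
case: (ltnP e b.-1) => [elt|ege]; rewrite /=.
  have := last_before_max elt eb; rewrite -/b' => eb'.
  have b'0 : b' <> 0 by lia.
  by rewrite (last_beforeP b'0) eb eqxx eb'; lia.
have -> : (e < b) = false by lia.
have := last_before_le lt (lt b.-1) b.-1; rewrite -/b' => le_b'.
by rewrite [e < b']ltnNge (leq_trans le_b' ege) !andbF.
Qed.

Section Grid.
Variables (W B Q : nat).
Hypothesis QBW : Q * B < 2 ^ W.
Hypothesis Q8 : 8 < Q.
Hypothesis B3 : 2 < B.

Let BW : Q + B * 4 < 2 ^ W.
Proof. by apply: leq_ltn_trans QBW; nia. Qed.

Let W0 : 0 < W.
Proof. by case: W QBW => //; nia. Qed.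

Lemma bucket_lettersP s N (lt : nat -> nat) :
  regs s rB = B -> regs s rN = N -> size (mem s) = Q * B -> N < B ->
  (forall p, p < N -> cell B (mem s) rowLT p = lt p /\ lt p < B) ->
  (forall p, p < B -> cell B (mem s) rowHD p = 0) ->
  runs W bucket_letters s (N * 100 + 6)
   (fun s' => [/\ forall q p, p < B -> q \notin [:: rowNX; rowHD] ->
          cell B (mem s') q p = cell B (mem s) q p,
          forall l, l < B -> cell B (mem s') rowHD l = last_before lt l N &
          forall p, p < N -> cell B (mem s') rowNX p = last_before lt (lt p) p]).
Proof.
move=> sB sN szs NB HLT HHD.
pose I u s' :=
  [/\ forall q p, p < B -> q \notin [:: rowNX; rowHD] ->
      cell B (mem s') q p = cell B (mem s) q p,
      forall l, l < B -> cell B (mem s') rowHD l = last_before lt l u &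
      forall p, p < u -> cell B (mem s') rowNX p = last_before lt (lt p) p].
apply: runs_weaken (@runs_for _ _ _ _ _ N I _ _ _ _ _ _ _ _ _) _ _ => //.
- lia.
- move=> u s' uN sz fr s'x [I1 I2 I3].
  have s'B : regs s' rB = B by rewrite fr.
  have s'N : regs s' rN = N by rewrite fr.
  have sz' : size (mem s') = Q * B by rewrite sz.
  have [HL HLB] := HLT u uN.
  have L1 : cell B (mem s') rowLT u = lt u by rewrite I1 //; lia.
  apply: wp_runs.
  step; rewrite L1. step. step. split.
  + move=> q p pB; rewrite !inE !negb_or => /andP[q1 q2]; cells.
    by rewrite (negbTE q1) (negbTE q2) /= I1 // !inE !negb_or q1.
  + move=> l lB; cells; rewrite eq_sym addn1; case: eqP => // _; exact: I2.
  + move=> p; rewrite ltnS => pu; cells.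
    case: eqP pu => [-> _|p1 p2]; first exact: I2.
    by apply: I3; rewrite ltn_neqAle p2 andbT; apply/eqP.
- by rewrite /=; lia.
- by move=> s' [].
Qed.

Lemma refineP s N (cl lt : nat -> nat) :
  regs s rB = B -> regs s rN = N -> size (mem s) = Q * B -> N < B ->
  (forall p, p < N -> cell B (mem s) rowLT p = lt p /\ lt p < B) ->
  (forall p, p < N -> cell B (mem s) rowCL p = cl p /\ cl p < B) ->
  (forall p, p < B -> cell B (mem s) rowHD p = 0) ->
  runs W refine s (N * 1000 + 100)
   (fun s' => [/\ forall q p, p < B -> q \notin [:: rowHD; rowNX; rowST; rowNW] ->
          cell B (mem s') q p = cell B (mem s) q p,
          forall l, l < B -> cell B (mem s') rowHD l = 0 &
          refines N cl lt (cell B (mem s') rowNW)]).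
Proof.
move=> sB sN szs NB HLT HCL HHD.
have h1 := runs_frame (bucket_lettersP sB sN szs NB HLT HHD).
apply: (@runs_leq _ _ _ (N * 100 + 6 + (4 + (N + N) * 200 + 10)));
    last by rewrite /=; lia.
apply: runs_seq h1 _ => s1 [sz1 fr1 [I1 I2 I3]].
have s1B : regs s1 rB = B by rewrite fr1.
have s1N : regs s1 rN = N by rewrite fr1.
have szs1 : size (mem s1) = Q * B by rewrite sz1.
(* Each turn lowers the measure: [enter_bucket] advances [a] and keeps the processed set,
   [group_step] processes one more position. Both summands start at most N, hence 2N turns. The last
   clause trusts ST only for classes having a processed position of the current letter. *)
pose J m s' := exists a b, [/\ N - a + count (fun e => ~~ processed lt a b e) (iota 0 N) <= m,
  [/\ regs s' ra = a, regs s' rb = b, regs s' rB = B, regs s' rN = N & size (mem s') = Q * B],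
  [/\ forall q p, p < B -> q \notin [:: rowHD; rowNX; rowST; rowNW] ->
          cell B (mem s') q p = cell B (mem s) q p,
      forall p, p < N -> cell B (mem s') rowNX p = last_before lt (lt p) p &
      forall l, l < B -> cell B (mem s') rowHD l =
         if last_before lt l a != 0 then 0 else last_before lt l N],
  [/\ a <= N, b <= N & b <> 0 -> last_before lt (lt b.-1) a <> 0] &
  [/\ forall e, e < N -> processed lt a b e ->
        let f := cell B (mem s') rowNW e in [/\ f < N, cl f = cl e & lt f = lt e],
      forall e e', e < N -> e' < N -> processed lt a b e -> processed lt a b e' ->
        cl e = cl e' -> lt e = lt e' ->
        cell B (mem s') rowNW e = cell B (mem s') rowNW e' &
      forall e, e < N -> processed lt a b e -> b <> 0 -> lt e = lt b.-1 ->
        cell B (mem s') rowST (cl e) = cell B (mem s') rowNW e]].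
have h2 : wp W (ra ::= Const 0 ;; rb ::= Const 0) (J (N + N)) s1.
  step. step.
  exists 0, 0; split=> //.
  - by rewrite subn0 leq_add2l (leq_trans (count_size _ _)) // size_iota.
  - split=> // q p pB.
    by rewrite !inE !negb_or => /and4P[q1 q2 q3 q4]; apply: I1; rewrite // !inE negb_or q1 q2.
have h2' := wp_runs h2.
apply: runs_weaken (@runs_seq _ _ _ _ _ ((N + N) * 200 + 10) _ _ h2' _) _ (fun s' => id).
  move=> s2 J2.
  apply: runs_weaken (@runs_while _ _ _ 190 J (N + N) s2 _ J2) _ _.
  2: by rewrite /=; lia.
  2:{ move=> s' [[m [a [b [hm [sa sb sB' sN' sz'] [K1 K2 K3] [aN bN bs] [P1 P2 P3]]]]]].
      have W1 : 1 < 2 ^ W by lia.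
      rewrite /= sa sb sN' /eval_op.
      rewrite [(a < N) %% _]modn_small; last by case: (a < N); lia.
      rewrite modn_small; last by case: (a < N); lia.
      case=> e0; have {e0} [aN' b0] : N = a /\ b = 0 by case: (ltnP a N) e0 => ? ?; lia.
      have done : forall e, e < N -> processed lt a b e.
        move=> e eN; rewrite /processed b0 /= andbT -aN'.
        by have := last_before_max eN (erefl (lt e)); case: (last_before).
      split=> //; first by move=> l lB; rewrite K3 // aN'; case: eqP.
      split=> [e eN|e e' eN e'N]; first exact: P1 (done e eN).
      by apply: P2; rewrite ?done. }
  move=> m s' [a [b [hm [sa sb sB' sN' sz'] [K1 K2 K3] [aN bN bs] [P1 P2 P3]]]].
  have W1 : 1 < 2 ^ W by lia.
  exists ((a < N) + b); first by ev; case: (a < N); lia.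
  move=> v0.
  have LT p : p < N -> cell B (mem s') rowLT p = lt p /\ lt p < B.
    by move=> pN; have [? ?] := HLT p pN; rewrite K1 //; lia.
  have CL p : p < N -> cell B (mem s') rowCL p = cl p /\ cl p < B.
    by move=> pN; have [? ?] := HCL p pN; rewrite K1 //; lia.
  have [b0|bN0] := eqVneq b 0.
  - have aN' : a < N by move: v0; rewrite b0; case: (a < N).
    exists m.-1; first by lia.
    have [La LaB] := LT a aN'.
    have sbv := ev_reg W sb; rewrite b0 in sbv.
    apply: runs_weaken (runs_if sbv (T := 150) _) _ (fun _ => id) => //=.
    suff h : wp W enter_bucket (J m.-1) s'.
      by have := wp_runs h; move/runs_weaken; apply.
    rewrite /enter_bucket; step; rewrite La. step; rewrite K3 //. step. step.
    set b' := if last_before lt (lt a) a != 0 then 0 else last_before lt (lt a) N.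
    exists a.+1, b'.
    have PE e : e < N -> processed lt a.+1 b' e = processed lt a b e.
      by move=> eN; rewrite b0; apply: processed_enter aN' eN _.
    split=> //.
    + have -> : count (fun e => ~~ processed lt a.+1 b' e) (iota 0 N) =
          count (fun e => ~~ processed lt a b e) (iota 0 N).
        by apply: eq_in_count => e; rewrite mem_iota => /andP[_ eN]; rewrite PE.
      by lia.
    + by split=> //; [rewrite upd_eq addn1 | sz].
    + split=> [q p pB|p pN|l lB].
      - rewrite !inE !negb_or => /and4P[q1 q2 q3 q4]; cells.
        by rewrite (negbTE q1) /= K1 // !inE !negb_or q1 q2 q3.
      - by cells; apply: K2.
      - cells; case: (eqVneq l (lt a)) => [//|nl]; exact: K3.
    + split=> //; rewrite /b'; first by case: ifP => // _; apply: last_before_le.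
      by case: ifP => // _ h; rewrite last_beforeP //= eqxx.
    + split=> [e eN|e e' eN e'N|e eN]; rewrite ?PE //; cells.
      - exact: P1.
      - by move=> *; cells; apply: P2.
      (* In a freshly entered bucket no position is processed, so the clause on ST is vacuous. *)
      - rewrite /b'; case: ifP => //= nseen; move/negbFE/eqP in nseen => pe h le.
        move: pe; rewrite /processed; rewrite last_beforeP // in le.
        by rewrite le nseen.
  - exists m.-1.
      suff : 0 < count (fun e => ~~ processed lt a b e) (iota 0 N) by lia.
      rewrite -has_count; apply/hasP; exists b.-1; first by rewrite mem_iota; lia.
      by rewrite /processed bN0 eqxx ltn_predL lt0n bN0 andbF.
    have sbv := ev_reg W sb.
    apply: runs_weaken (runs_if sbv (T := 180) _) _ (fun _ => id) => //=.
    rewrite bN0; suff h : wp W group_step (J m.-1) s'.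
      by have := wp_runs h; move/runs_weaken; apply.
    case: b bN0 sb hm bN bs P1 P2 P3 {sbv v0} => // e0 _ sb hm e0N bs0 P1 P2 P3.
    have bs : last_before lt (lt e0) a <> 0 by apply: bs0.
    have [Le LeB] := LT e0 e0N; have [Ce CeB] := CL e0 e0N.
    have notP : ~~ processed lt a e0.+1 e0 by rewrite /processed /= eqxx leqnn andbF.
    (* The common end of both branches: [g] is the name given to [e0], either a verified entry of ST
       or [e0] itself, and it agrees with every name already given to that class and letter. *)
    have main s2' g :
      [/\ regs s2' rx = e0, regs s2' rf = g, regs s2' ra = a, regs s2' rB = B & regs s2' rN = N] ->
      [/\ size (mem s2') = Q * B,
        forall q p, p < B -> q != rowST -> cell B (mem s2') q p = cell B (mem s') q p,
        forall c, c < B -> c != cl e0 -> cell B (mem s2') rowST c = cell B (mem s') rowST c &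
        cell B (mem s2') rowST (cl e0) = g] ->
      [/\ g < N, cl g = cl e0 & lt g = lt e0] ->
      (forall e, e < N -> processed lt a e0.+1 e -> cl e = cl e0 -> lt e = lt e0 ->
         cell B (mem s') rowNW e = g) ->
      wp W (PutAt (Const rowNW) (Reg rx) (Reg rf) ;; rb ::= At (Const rowNX) (Reg rx)) (J m.-1) s2'.
    + move=> [s2x s2f s2a s2B s2N] [sz2 M1 M2 M3] [g1 g2 g3] U.
      step. step. cells. rewrite M1 //; last by lia.
      rewrite K2 //.
      have PE e : processed lt a (last_before lt (lt e0) e0) e =
          processed lt a e0.+1 e || (e == e0).
        by apply: (@processed_group lt a e0.+1 e).
      have bN : last_before lt (lt e0) e0 <= e0 by apply: last_before_le.
      exists a, (last_before lt (lt e0) e0); split=> //.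
      * have : count (fun e => ~~ processed lt a (last_before lt (lt e0) e0) e) (iota 0 N) <
               count (fun e => ~~ processed lt a e0.+1 e) (iota 0 N).
          apply: (@count_lt _ _ _ e0) => //; last by rewrite PE eqxx orbT.
            by move=> e _; rewrite PE negb_or => /andP[].
          by rewrite mem_iota.
        by lia.
      * by split=> //; sz.
      * split=> [q p pB|p pN|l lB].
        - rewrite !inE !negb_or => /and4P[q1 q2 q3 q4]; cells.
          by rewrite (negbTE q4) /= M1 // K1 // !inE !negb_or q1 q2 q3.
        - by cells; rewrite M1 ?K2 //; lia.
        - by cells; rewrite M1 ?K3.
      * split=> //; first by lia.
        by move=> h; rewrite (last_beforeP h).
      * split=> [e eN|e e' eN e'N|e eN]; rewrite ?PE.
        - cells; case: (eqVneq e e0) => [-> _|_] //=.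
          by rewrite orbF M1 //; [apply: P1 | lia].
        - move=> pe pe' ce le; cells; move: pe pe' ce le.
          case: (eqVneq e e0) => [->|ne] /=; case: (eqVneq e' e0) => [->|ne'] /=; rewrite ?orbF //.
          + by move=> _ pe ce le; rewrite M1 //; [rewrite (U e') | lia].
          + by move=> pe _ ce le; rewrite M1 //; [rewrite (U e) | lia].
          + by move=> pe pe' ce le; rewrite !M1 //; [apply: P2 | lia | lia].
        - move=> pe h; rewrite (last_beforeP h) => le; have [_ ceB] := CL e eN; cells.
          move: pe; case: (eqVneq e e0) => [-> _|ne] /=; rewrite ?orbF ?M3 //.
          move=> pe; rewrite [cell _ _ 7 e]M1 //; last by lia.
          case: (eqVneq (cl e) (cl e0)) => [ce|nce].
            by rewrite ce M3 (U e).
          by rewrite M2 // P3.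
    + rewrite /group_step; step. rewrite subn1 succnK. step; rewrite Ce. step.
      set f := cell B (mem s') rowST (cl e0).
      have fresh s2' :
        [/\ regs s2' rx = e0, regs s2' rc = cl e0, regs s2' ra = a,
          regs s2' rB = B & regs s2' rN = N] ->
        mem s2' = mem s' -> ~ [/\ f < N, cl f = cl e0 & lt f = lt e0] ->
        wp W (PutAt (Const rowST) (Reg rc) (Reg rx) ;; rf ::= Reg rx)
          (wp W (PutAt (Const rowNW) (Reg rx) (Reg rf) ;; rb ::= At (Const rowNX) (Reg rx))
            (J m.-1)) s2'.
        move=> [s2x s2c s2a s2B s2N] m2 nv.
        have sz2 : size (mem s2') = Q * B by rewrite m2.
        step. step. apply: (main _ e0) => //.
        + split; [sz | | |].
          * move=> q p pB q1; cells; by rewrite (negbTE q1) m2.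
          * move=> c cB c1; cells; by rewrite (negbTE c1) m2.
          * by cells; rewrite eqxx.
        (* A processed position with the class and letter of [e0] would, by the clause on ST, have
           made the entry pass the tests. *)
        + move=> e eN pe ce le; case: nv; rewrite /f -ce P3 //.
          by have [? ? ?] := P1 e eN pe; rewrite -le.
      step. step => fN.
      * have {}fN : f < N by case: (f < N) fN.
        have [Lf LfB] := LT f fN; have [Cf CfB] := CL f fN.
        step; rewrite !mem_upd Lf Cf Le. step => vP.
        - step. apply: (main _ f).
          + by split; rg.
          + by split=> //; sz.
          + by move: vP; case: eqP => // ->; case: eqP => // ->.
          + by move=> e eN pe ce le; rewrite -(P3 e) ?ce.
        - apply: fresh => //.
          by case=> _ ce le; move: vP; rewrite ce le !eqxx.
      * step. step => vP //.
        apply: fresh => //.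
        by case=> fN1; rewrite fN1 in fN.
by rewrite /=; lia.
Qed.

Definition fill (row : nat) (e : expr) : cmd :=
  For rp rN (PutAt (Const row) (Reg rp) e).

(** * Repetition tables *)

Definition sweep_bound : cmd :=
  If (Reg ri +' Reg rd <' Reg rN) (re ::= At rowE (Reg ri +' Reg rd)) (re ::= Reg rn).

(* Stale entries of ST are harmless: a position q > ri with the same name has been
   visited by this sweep and has then overwritten the entry, so that an entry
   passing the tests is the nearest such q. *)
Definition sweep_repeat : cmd :=
  If (Reg ri <' Reg rq)
    (If (Reg rq <' Reg rN)
      (If (At (Const rowNW) (Reg rq) ==' Reg rx)
        (If (Reg rq <' Reg re) (re ::= Reg rq) Skip) Skip) Skip) Skip.

Definition sweep_step : cmd :=
  ri ::= Reg rN -' Const 1 -' Reg rp ;;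
  sweep_bound ;;
  rx ::= At (Const rowNW) (Reg ri) ;;
  rq ::= At (Const rowST) (Reg rx) ;;
  sweep_repeat ;;
  PutAt (Const rowST) (Reg rx) (Reg ri) ;;
  PutAt rowE (Reg ri) (Reg re).

Definition sweep : cmd := For rp rN sweep_step.

(** Only [p] is required to be congruent to [i]: the names used separate residues modulo d, so [q]
    follows. *)
Definition repeats (d : nat) (nw : nat -> nat) (i x : nat) : Prop :=
  exists p q, [/\ i <= p, p < q, q <= x, p = i %[mod d] & nw p = nw q].

Lemma fillP s N row e (f : nat -> nat) :
  regs s rB = B -> regs s rN = N -> size (mem s) = Q * B -> N <= B -> row <= 7 ->
  (forall p s', p < N -> regs s' rp = p -> (forall y, y != rp -> regs s' y = regs s y) ->
     size (mem s') = Q * B ->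
     (forall q x, x < B -> q != row -> cell B (mem s') q x = cell B (mem s) q x) ->
     eval W s' e = Some (f p)) ->
  runs W (fill row e) s (N * (expr_cost e + 20) + 6)
    (fun s' => (forall q x, x < B -> q != row -> cell B (mem s') q x = cell B (mem s) q x) /\
               (forall p, p < N -> cell B (mem s') row p = f p)).
Proof.
move=> sB sN szs NB row7 he.
pose I u s' := (forall q x, x < B -> q != row -> cell B (mem s') q x = cell B (mem s) q x) /\
  (forall p, p < u -> cell B (mem s') row p = f p).
apply: runs_weaken (@runs_for _ _ _ _ _ N I _ _ _ _ _ _ _ _ _) _ _ => //.
- lia.
- move=> u s' uN sz fr s'x [I1 I2].
  have s'B : regs s' rB = B by rewrite fr.
  have sz' : size (mem s') = Q * B by rewrite sz.
  apply: wp_runs; eapply wp_put; [eassumption|eassumption|eassumption|ev|ev|side|side| |].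
    by apply: (he u) => // y yp; apply: fr; rewrite inE.
  split=> [q x xB qr|p]; cells.
    by rewrite (negbTE qr) /= I1.
  rewrite ltnS => pu; cells; rewrite eqxx /=; case: eqP => [-> //|pu'].
  by apply: I2; rewrite ltn_neqAle pu andbT; apply/eqP.
- by rewrite /=; lia.
- by move=> s' [].
Qed.

Lemma copyP s N src dst :
  regs s rB = B -> regs s rN = N -> size (mem s) = Q * B -> N <= B ->
  src <= 7 -> dst <= 7 -> src != dst ->
  runs W (fill dst (At (Const src) (Reg rp))) s (N * 40 + 6)
    (fun s' => (forall q x, x < B -> q != dst -> cell B (mem s') q x = cell B (mem s) q x) /\
               (forall p, p < N -> cell B (mem s') dst p = cell B (mem s) src p)).
Proof.
move=> sB sN szs NB src7 dst7 sd.
apply: runs_weaken (@fillP _ _ _ _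
  (cell B (mem s) src) sB sN szs NB _ _) _ _ => //;
  last by rewrite /=; lia.
move=> p s' pN s'p fr sz' M.
have s'B : regs s' rB = B by rewrite fr.
rewrite -M //; last by lia.
by ev.
Qed.

(** The recurrence behind the sweep: the first member of a repetition is either [i] or, being
    congruent to [i] and larger, at least i + d. *)
Lemma repeats_step d nw N i x : 0 < d -> i < N -> x < N ->
  (forall p q, p < N -> q < N -> nw p = nw q -> p = q %[mod d]) ->
  repeats d nw i x <->
  (repeats d nw (i + d) x \/ exists2 q, i < q <= x & nw q = nw i).
Proof.
move=> d0 iN xN res; split.
  case=> p [q [ip pq qx pi nwpq]].
  case: (eqVneq p i) => [pe|pn]; first by right; exists q; rewrite -pe ?pq // nwpq.
  left; exists p, q; split=> //; last by rewrite modnDr.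
  have := divn_eq (p - i) d.
  have -> : (p - i) %% d = 0.
    by apply/eqP; rewrite -/(dvdn d _) -eqn_mod_dvd //; apply/eqP.
  move=> e; have : 0 < p - i by lia.
  rewrite {1}e addn0 => pos; have : d <= (p - i) %/ d * d by apply: leq_pmull; lia.
  by rewrite -[X in _ <= X]addn0 -e; lia.
case=> [[p [q [ip pq qx pi nwpq]]]|[q /andP[iq qx] nwq]].
  by exists p, q; split=> //; [lia | rewrite pi modnDr].
by exists i, q.
Qed.

(** Entries are specified through their comparisons with x < N only, so [n], which is at least N,
    can stand for the absence of a repetition. *)
Lemma sweepP s N n d nw :
  regs s rB = B -> regs s rN = N -> regs s rn = n -> regs s rd = d ->
  size (mem s) = Q * B -> N < B -> N <= n -> 0 < d -> 7 + d < Q ->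
  (forall p, p < N -> cell B (mem s) rowNW p = nw p /\ nw p < B) ->
  (forall p q, p < N -> q < N -> nw p = nw q -> p = q %[mod d]) ->
  runs W sweep s (N * 200 + 6)
    (fun s' => (forall q x, x < B -> q \notin [:: rowST; 7 + d] ->
                  cell B (mem s') q x = cell B (mem s) q x) /\
      (forall i x, i < N -> x < N ->
         cell B (mem s') (7 + d) i <= x <-> repeats d nw i x)).
Proof.
move=> sB sN sn sd szs NB Nn d0 dQ HNW res.
pose I u s' := [/\
  forall q x, x < B -> q \notin [:: rowST; 7 + d] -> cell B (mem s') q x = cell B (mem s) q x,
  forall i x, N - u <= i -> i < N -> x < N ->
         cell B (mem s') (7 + d) i <= x <-> repeats d nw i x &
  (* Positions from N - u on have been visited. As q <= i holds for every visited i with that name,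
     the entry is the leftmost of them, hence the nearest one to the right of the next position. *)
  forall i, N - u <= i -> i < N ->
    let q := cell B (mem s') rowST (nw i) in [/\ N - u <= q, q <= i & nw q = nw i]].
apply: runs_weaken (@runs_for _ _ _ _ 180 N I _ _ _ _ _ _ _ _ _) _ _ => //.
- lia.
- by split=> // i *; lia.
- move=> u s' uN sz fr s'x [I1 I2 I3].
  have s'B : regs s' rB = B by rewrite fr.
  have s'N : regs s' rN = N by rewrite fr.
  have s'n : regs s' rn = n by rewrite fr.
  have s'd : regs s' rd = d by rewrite fr.
  have sz' : size (mem s') = Q * B by rewrite sz.
  apply: (@runs_weaken _ _ _ (cmd_cost sweep_step)); last by move=> ?; apply.
    2: by [].
  apply: wp_runs; rewrite /sweep_step.
  set i := N - 1 - u.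
  have iN : i < N by rewrite /i; lia.
  have NWi p : p < N -> cell B (mem s') rowNW p = nw p.
    by move=> pN; have [<- _] := HNW p pN; apply: I1; rewrite // ?inE; lia.
  have [_ nwB] := HNW i iN.
  step. rewrite -/i.
  apply: wp_seq; rewrite /sweep_bound.
  pose e := if i + d < N then cell B (mem s') (7 + d) (i + d) else n.
  apply: (@wp_mono _ _ (fun s2 => [/\ mem s2 = mem s', regs s2 re = e, regs s2 ri = i &
      forall y, y \notin [:: re; ri] -> regs s2 y = regs s' y])).
    step => ide; step.
      split=> //; rewrite ?upd_eq ?mem_upd.
        by rewrite /e; case: ifP ide.
      by move=> y; rewrite !inE negb_or => /andP[/negbTE y1 /negbTE y2]; rewrite !upd_ne.
    split=> //; rewrite ?upd_eq ?mem_upd.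
      by rewrite /e; case: ifP ide.
    by move=> y; rewrite !inE negb_or => /andP[/negbTE y1 /negbTE y2]; rewrite !upd_ne.
  move=> s2 [m2 s2e s2i fr2].
  have s2B : regs s2 rB = B by rewrite fr2.
  have s2N : regs s2 rN = N by rewrite fr2.
  have s2d : regs s2 rd = d by rewrite fr2.
  have sz2 : size (mem s2) = Q * B by rewrite m2.
  step; rewrite m2 NWi //. step; rewrite mem_upd m2.
  set q := cell B (mem s') rowST (nw i).
  apply: wp_seq; rewrite /sweep_repeat.
  pose e' := if [&& i < q, q < N, nw q == nw i & q < e] then q else e.
  apply: (@wp_mono _ _ (fun s3 => [/\ mem s3 = mem s', regs s3 re = e' &
      forall y, y != re -> regs s3 y = regs (upd (upd s2 rx (nw i)) rq q) y])).
    have skip : e' = e -> wp W Skip (fun s3 => [/\ mem s3 = mem s', regs s3 re = e' &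
        forall y, y != re -> regs s3 y = regs (upd (upd s2 rx (nw i)) rq q) y])
        (upd (upd s2 rx (nw i)) rq q).
      by move=> ->; step; split=> //; rg.
    rewrite /e' in skip *; step => c1; last by apply: skip; case: (i < q) c1.
    move: skip; have -> /= : i < q by case: (i < q) c1.
    move=> skip; step => c2; last by apply: skip; case: (q < N) c2.
    have qN : q < N by case: (q < N) c2.
    move: skip; rewrite qN /= => skip.
    step; rewrite ?mem_upd m2 NWi // => c3; last by apply: skip; case: (_ == _) c3.
    move: skip; have -> /= : nw q == nw i by case: (_ == _) c3.
    move=> skip; step => c4; last by apply: skip; case: (q < e) c4.
    have -> : q < e by case: (q < e) c4.
    step; split=> // y yre; by rewrite upd_ne //; apply/negbTE.
  move=> s3 [m3 s3e fr3].
  have s3B : regs s3 rB = B by rewrite fr3 //; rg.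
  have s3i : regs s3 ri = i by rewrite fr3 //; rg.
  have s3x : regs s3 rx = nw i by rewrite fr3 //; rg.
  have s3d : regs s3 rd = d by rewrite fr3 //; rg.
  have sz3 : size (mem s3) = Q * B by rewrite m3.
  step. step. rewrite !mem_sto m3.
  have Ni : N - u.+1 = i by rewrite /i; lia.
  have Nu : N - u = i.+1 by rewrite /i; lia.
  have d4 : (4 == 7 + d) = false by lia.
  have d4' : (7 + d == 4) = false by lia.
  rewrite Nu in I2 I3.
  split; rewrite ?Ni.
  + move=> r x xB; rewrite !inE negb_or => /andP[r1 r2]; cells.
    by rewrite (negbTE r1) (negbTE r2) /= I1 // !inE negb_or r1.
  + move=> k x ik kN xN; cells; rewrite eqxx /=.
    case: (eqVneq k i) => [->|ki]; last first.
      by rewrite ?d4' /=; apply: I2 => //; lia.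
    rewrite (repeats_step d0 iN xN res).
    have Ee : e <= x <-> repeats d nw (i + d) x.
      rewrite /e; case: ltnP => idN; first by apply: I2 => //; lia.
      by split; [lia | case=> p [p' [? ? ? _ _]]; lia].
    (* The stored [q] lies at or before every later position with the name of [i], so testing it
       alone decides existence. *)
    have Eq : (i < q) && (q < N) && (nw q == nw i) && (q <= x) <->
        exists2 q', i < q' <= x & nw q' = nw i.
      split=> [/andP[/andP[/andP[h1 h2] /eqP h3] h4]|[q' /andP[h1 h2] h3]].
        by exists q => //; rewrite h1.
      have [] := I3 q' h1 (leq_ltn_trans h2 xN); rewrite h3 -/q => g1 g2 ->.
      by rewrite g1 eqxx; lia.
    rewrite -Ee -Eq /e'; case: (i < q); case: (q < N); case: (nw q == nw i);
      rewrite /=; case: ltnP; lia.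
  + move=> k ik kN; have [_ kB] := HNW k kN; cells; rewrite ?d4 /=.
    case: (eqVneq (nw k) (nw i)) => [->|nk] /=; first by split.
    have ik' : i < k by rewrite ltn_neqAle ik andbT; apply: contraNneq nk => ->.
    have [g1 g2 g3] := I3 k ik' kN.
    by split=> //; lia.
- lia.
- move=> s' [_ _ [I1 I2 _]]; split=> // i x iN xN; apply: I2 => //; lia.
Qed.

End Grid.

(** * Construction *)

(* Letters may be as large as n ^ c, so they are fed to [refine] one digit in base
   n + 1 at a time. *)
Definition digit_step : cmd :=
  fill rowLT (At (Const rowW) (Reg rp +' Reg rm) /' Reg rpw %' (Reg rn +' Const 1)) ;;
  refine ;;
  fill rowCL (At (Const rowNW) (Reg rp)) ;;
  rpw ::= Reg rpw *' (Reg rn +' Const 1).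

(* The second refinement separates residues modulo the block length, so that equal
   names mean equal blocks at positions reachable from one another. *)
Definition length_step : cmd :=
  (rN ::= Reg rn -' Reg rm ;; rpw ::= Const 1) ;;
  For rt rcb digit_step ;;
  rd ::= Reg rm +' Const 1 ;;
  fill rowLT (Reg rp %' Reg rd) ;;
  refine ;;
  sweep.

Definition build (c : nat) : cmd :=
  (rn ::= Reg 0 ;; rs ::= Reg 0 /' Reg 1 ;; rB ::= Reg 0 +' Const 2 ;; rcb ::= Const c.+1) ;;
  For rm rs length_step ;;
  fill rowID (At (Const rowCL) (Reg rp)) ;;
  PutAt (Const 0) (Const 0) (Reg rn) ;;
  PutAt (Const 0) (Const 1) (Reg rs).

(** * Equality of factors and of digits *)

Definition same_factor (w : seq nat) (m p q : nat) : Prop :=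
  forall x, x < m -> nth 0 w (p + x) = nth 0 w (q + x).

Lemma same_factorS w m p q :
  same_factor w m.+1 p q <-> same_factor w m p q /\ nth 0 w (p + m) = nth 0 w (q + m).
Proof.
split=> [h|[h1 h2] x].
  by split=> [x xm|]; apply: h; [apply: ltnW | apply: leqnn].
by rewrite ltnS leq_eqVlt => /orP[/eqP-> //|]; apply: h1.
Qed.

(** With [a] a power of the base [b], the second condition compares the next digit; agreement on the
    digits read so far is congruence modulo a power of the base. *)
Lemma modn_mul_eq a b x y : 0 < a ->
  x = y %[mod a * b] <-> x = y %[mod a] /\ (x %/ a) %% b = (y %/ a) %% b.
Proof.
move=> a0; rewrite !modn_divl [b * a]mulnC; split=> [h|[h1 h2]].
  by rewrite h; split=> //; rewrite -(modn_dvdm x (dvdn_mulr b (dvdnn a))) h modn_dvdm // dvdn_mulr.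
rewrite [LHS](divn_eq _ a) [RHS](divn_eq _ a) h2.
by rewrite !modn_dvdm ?dvdn_mulr // h1.
Qed.

Lemma refines_eq N cl lt nw a b : refines N cl lt nw -> a < N -> b < N ->
  nw a = nw b <-> cl a = cl b /\ lt a = lt b.
Proof.
move=> [h1 h2] aN bN; split=> [e|[]]; last exact: h2.
have [_ <- <-] := h1 a aN; have [_ <- <-] := h1 b bN.
by rewrite e.
Qed.

Section Build.
Variables (W n B Q c : nat) (w : seq nat).
Hypothesis QBW : Q * B < 2 ^ W.
Hypothesis Q8 : 8 < Q.
Hypothesis n0 : 0 < n.
Hypothesis Bn : B = n + 2.
Hypothesis cW : c.+1 < 2 ^ W.
Hypothesis ncW : n.+1 ^ c.+1 < 2 ^ W.
Hypothesis wn : forall p, p < n -> nth 0 w p < n.+1 ^ c.+1.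

Let B3 : 2 < B.
Proof. by rewrite Bn; lia. Qed.

Let BW : Q + B * 4 < 2 ^ W.
Proof. by apply: leq_ltn_trans QBW; nia. Qed.

Let W0 : 0 < W.
Proof. by case: W QBW => //; nia. Qed.

Definition named (m N : nat) (mm : seq nat) : Prop :=
  forall p q, p < N -> q < N ->
    (cell B mm rowCL p = cell B mm rowCL q <-> same_factor w m p q).

Definition outside (rows : seq nat) (m1 m2 : seq nat) : Prop :=
  forall q x, x < B -> q \notin rows -> cell B m2 q x = cell B m1 q x.

Definition small_row (q N : nat) (mm : seq nat) : Prop :=
  forall p, p < N -> cell B mm q p < B.

Definition clear_row (q : nat) (mm : seq nat) : Prop :=
  forall p, p < B -> cell B mm q p = 0.

Definition holds_word (mm : seq nat) : Prop :=
  forall p, p < n -> cell B mm rowW p = nth 0 w p.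

Lemma digitsP s m N :
  regs s rB = B -> regs s rN = N -> regs s rn = n -> regs s rm = m ->
  regs s rcb = c.+1 -> regs s rpw = 1 -> size (mem s) = Q * B ->
  m < n -> N = n - m ->
  holds_word (mem s) -> clear_row rowHD (mem s) ->
  small_row rowCL N (mem s) -> named m N (mem s) ->
  runs W (For rt rcb digit_step) s (c.+1 * (N * 1100 + 150) + 6)
    (fun s' => [/\ outside scratch (mem s) (mem s'), clear_row rowHD (mem s'),
       small_row rowCL N (mem s') & named m.+1 N (mem s')]).
Proof.
move=> sB sN sn sm scb spw szs mn Nnm HW HH HC HN.
pose I t s' := [/\ outside scratch (mem s) (mem s'), clear_row rowHD (mem s'),
  small_row rowCL N (mem s'), regs s' rpw = n.+1 ^ t &
  forall p q, p < N -> q < N ->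
    (cell B (mem s') rowCL p = cell B (mem s') rowCL q <->
     same_factor w m p q /\ nth 0 w (p + m) = nth 0 w (q + m) %[mod n.+1 ^ t])].
apply: runs_weaken (@runs_for _ _ _ _ (N * 1100 + 142) c.+1 I _ _ _ _ _ _ _ _ _) _ _ => //.
- split=> // p q pN qN; rewrite HN // expn0 !modn1; by split=> [h|[]].
- move=> t s' tc sz fr s't [I1 I2 I3 I4 I5].
  have s'B : regs s' rB = B by rewrite fr.
  have s'N : regs s' rN = N by rewrite fr.
  have s'n : regs s' rn = n by rewrite fr.
  have s'm : regs s' rm = m by rewrite fr.
  have sz' : size (mem s') = Q * B by rewrite sz.
  have pwW : n.+1 ^ t * n.+1 < 2 ^ W.
    by rewrite -expnSr; apply: leq_ltn_trans ncW; rewrite leq_exp2l.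
  have NB : N < B by lia.
  pose f p := (nth 0 w (p + m) %/ n.+1 ^ t) %% n.+1.
  apply: (@runs_leq _ _ _ ((N * 50 + 6) + ((N * 1000 + 100) + ((N * 40 + 6) + 6))));
      last by lia.
  have h1 : runs W
      (fill rowLT (At (Const rowW) (Reg rp +' Reg rm) /' Reg rpw %' (Reg rn +' Const 1)))
      s' (N * 50 + 6)
    (fun s1 => (forall q x, x < B -> q != rowLT -> cell B (mem s1) q x = cell B (mem s') q x) /\
               (forall p, p < N -> cell B (mem s1) rowLT p = f p)).
    apply: runs_weaken (@fillP _ _ _ QBW Q8 B3 _ _ _ _
      f s'B s'N sz' (ltnW NB) _ _) _ _ => //;
      last by rewrite /=; lia.
    move=> p s1 pN s1p fr1 sz1 M1;
    have s1B : regs s1 rB = B by rewrite fr1.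
    have s1m : regs s1 rm = m by rewrite fr1.
    have s1n : regs s1 rn = n by rewrite fr1.
    have s1pw : regs s1 rpw = n.+1 ^ t by rewrite fr1.
    have v : cell B (mem s1) rowW (p + m) = nth 0 w (p + m).
      by rewrite M1 //; [rewrite I1 //; [apply: HW; lia | lia] | lia].
    have vW : cell B (mem s1) rowW (p + m) < 2 ^ W.
      by rewrite v; apply: ltn_trans (wn _) ncW; lia.
    have vW' := leq_ltn_trans (leq_div (cell B (mem s1) rowW (p + m)) (n.+1 ^ t)) vW.
    by rewrite /f -v -[in X in _ %% X]addn1; ev.
  have fB p : f p < B by rewrite /f; apply: (@leq_trans n.+1); [apply: ltn_pmod | lia].
  apply: runs_seq (runs_frame h1) _ => s1 [sz1 fr1 [M1 M2]].
  have s1B : regs s1 rB = B by rewrite fr1.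
  have s1N : regs s1 rN = N by rewrite fr1.
  have szs1 : size (mem s1) = Q * B by rewrite sz1.
  have h2 := @refineP _ _ _ QBW Q8 B3 s1 N (cell B (mem s') rowCL) f s1B s1N szs1 NB.
  apply: runs_seq (runs_frame (h2 _ _ _)) _.
  - by move=> p pN; split; [apply: M2 | apply: fB].
  - by move=> p pN; split; [apply: M1 => //; lia | apply: I3].
  - by move=> p pB; rewrite M1 // I2.
  move=> s2 [sz2 fr2 [R1 R2 R3]].
  have s2B : regs s2 rB = B by rewrite fr2.
  have s2N : regs s2 rN = N by rewrite fr2.
  have szs2 : size (mem s2) = Q * B by rewrite sz2.
  have h3 := @copyP _ _ _ QBW Q8 B3 s2 N rowNW rowCL s2B s2N szs2 (ltnW NB) isT isT isT.
  apply: runs_seq (runs_frame h3) _ => s3 [sz3 fr3 [T1 T2]].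
  have s3pw : regs s3 rpw = n.+1 ^ t by rewrite fr3 // fr2 // fr1.
  have s3n : regs s3 rn = n by rewrite fr3 // fr2 // fr1.
  rewrite -addn1 in pwW.
  apply: (@runs_wp _ _ _ _ (fun s4 => I t.+1 (upd s4 rt t.+1))); last by [].
  have lpW : n + 1 < 2 ^ W by lia.
  step; split=> //.
  + move=> q x xB qr; rewrite !mem_upd.
    move: (qr); rewrite !inE !negb_or => /and5P[q1 q2 q3 q4 /andP[q5 q6]].
    rewrite T1 // R1 //; last by rewrite !inE !negb_or q1 q2 q3.
    by rewrite M1 // I1.
  + by move=> p pB; rewrite !mem_upd T1 // R2.
  + by move=> p pN; rewrite !mem_upd T2 //; have [nwN _ _] := R3.1 p pN; lia.
  + by rewrite upd_ne // upd_eq addn1 expnSr.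
  + move=> p q pN qN; rewrite !mem_upd !T2 // (refines_eq R3 pN qN) I5 //.
    by rewrite expnSr modn_mul_eq ?expn_gt0 // /f; tauto.
- by lia.
- move=> s' [_ _ [I1 I2 I3 I4 I5]]; split=> // p q pN qN.
  (* All letters lie below [n.+1 ^ c.+1], so congruence after the last digit is equality. *)
  rewrite I5 // same_factorS !modn_small; try by apply: wn; lia.
  by [].
Qed.

(** The condition x + d <= n says that a block may start at [x]. The congruence of [q] is explicit
    here, because [same_factor] knows nothing of residues. *)
Definition repeat_table (d : nat) (mm : seq nat) : Prop :=
  forall i x, i <= x -> x + d <= n ->
  (cell B mm (7 + d) i <= x <->
   exists p q, [/\ i <= p, p < q, q <= x, (p = i %[mod d] /\ q = i %[mod d]) &
     same_factor w d p q]).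

Definition length_inv (m : nat) (mm : seq nat) : Prop :=
  [/\ holds_word mm, clear_row rowHD mm, small_row rowCL (n - m + 1) mm,
      named m (n - m + 1) mm & forall d, 0 < d <= m -> repeat_table d mm].

Lemma length_stepP s m :
  regs s rB = B -> regs s rn = n -> regs s rm = m -> regs s rcb = c.+1 ->
  size (mem s) = Q * B -> m < n -> 8 + m < Q ->
  length_inv m (mem s) ->
  runs W length_step s (c.+1 * (n * 1100 + 150) + n * 1300 + 150)
    (fun s' => regs s' rN = n - m /\ length_inv m.+1 (mem s')).
Proof.
move=> sB sn sm scb szs mn mQ [HW HH HC HN HT].
pose N := n - m.
(* Exactly n - m positions start a factor of length [m.+1]; the turn works on these. *)
have Nm : n - m.+1 + 1 = N by rewrite /N; lia.
apply: (@runs_leq _ _ _ (6 + ((c.+1 * (N * 1100 + 150) + 6) +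
    (4 + ((N * 40 + 6) + ((N * 1000 + 100) + (N * 200 + 6))))))); last first.
  have Nn : N <= n by rewrite /N; lia.
  have : c.+1 * (N * 1100 + 150) <= c.+1 * (n * 1100 + 150).
    by rewrite leq_mul2l leq_add2r leq_mul2r Nn !orbT.
  by lia.
apply: (@runs_wp_seq _ _ _ _ _ _ (fun s1 => s1 = upd (upd s rN (n - m)) rpw 1)) => //.
  by step; step.
move=> s1 s1E.
have h1 : runs W (For rt rcb digit_step) s1 (c.+1 * (N * 1100 + 150) + 6)
    (fun s' => [/\ outside scratch (mem s1) (mem s'), clear_row rowHD (mem s'),
       small_row rowCL N (mem s') & named m.+1 N (mem s')]).
  rewrite s1E; apply: (@digitsP _ m) => //.
  - by move=> p pN; apply: HC; lia.
  - by move=> p q pN qN; apply: HN; lia.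
apply: runs_seq (runs_frame h1) _ => s2 [sz2 fr2 [D1 D2 D3 D4]].
have s2m : regs s2 rm = m by rewrite fr2 // s1E.
have m1 : mem s1 = mem s by rewrite s1E.
apply: (@runs_wp_seq _ _ _ _ _ _ (fun s3 => s3 = upd s2 rd (m + 1))) => //.
  by step.
move=> s3 s3E.
have s3B : regs s3 rB = B by rewrite s3E upd_ne // fr2 // s1E.
have s3N : regs s3 rN = N by rewrite s3E upd_ne // fr2 // s1E.
have s3n : regs s3 rn = n by rewrite s3E upd_ne // fr2 // s1E.
have s3d : regs s3 rd = m.+1 by rewrite s3E upd_eq addn1.
have m3 : mem s3 = mem s2 by rewrite s3E.
have szs3 : size (mem s3) = Q * B by rewrite m3 sz2 m1.
have NB : N < B by rewrite /N; lia.
have h3 : runs W (fill rowLT (Reg rp %' Reg rd)) s3 (N * 40 + 6)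
    (fun s' => (forall q x, x < B -> q != rowLT -> cell B (mem s') q x = cell B (mem s3) q x) /\
               (forall p, p < N -> cell B (mem s') rowLT p = p %% m.+1)).
  apply: runs_weaken (@fillP _ _ _ QBW Q8 B3 _ _ _ _
    (modn^~ m.+1) s3B s3N szs3 (ltnW NB) _ _) _ _ => //;
    last by rewrite /=; lia.
  move=> p s' pN s'p fr' sz' M.
  have s'd : regs s' rd = m.+1 by rewrite fr'.
  by ev.
apply: runs_seq (runs_frame h3) _ => s4 [sz4 fr4 [F1 F2]].
have s4B : regs s4 rB = B by rewrite fr4.
have s4N : regs s4 rN = N by rewrite fr4.
have szs4 : size (mem s4) = Q * B by rewrite sz4.
have h4 := @refineP _ _ _ QBW Q8 B3 s4 N (cell B (mem s3) rowCL) (modn^~ m.+1) s4B s4N szs4 NB.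
apply: runs_seq (runs_frame (h4 _ _ _)) _.
- by move=> p pN; split; [apply: F2 | apply: (leq_ltn_trans (leq_mod _ _)); lia].
- by move=> p pN; split; [apply: F1 => //; lia | rewrite m3; apply: D3].
- by move=> p pB; rewrite F1 // m3 D2.
move=> s5 [sz5 fr5 [R1 R2 R3]].
set nw := cell B (mem s5) rowNW in R3.
have h5 := @sweepP _ _ _ QBW Q8 B3 s5 N n m.+1 nw.
apply: runs_weaken (runs_frame (h5 _ _ _ _ _ _ _ _ _ _ _)) _ _ => //;
  rewrite ?fr5 ?fr4 ?sz5 ?sz4 //; try by rewrite /N; lia.
- by move=> p pN; split=> //; have [? _ _] := R3.1 p pN; lia.
- by move=> p q pN qN /(refines_eq R3 pN qN) [].
move=> s6 [sz6 fr6 [S1 S2]]; split; first by rewrite fr6 // fr5 // fr4.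
have keep q x : x < B -> q \notin scratch -> q != 8 + m -> cell B (mem s6) q x = cell B (mem s) q x.
  move=> xB qr qm; move: (qr); rewrite !inE !negb_or => /and5P[q1 q2 q3 q4 /andP[q5 q6]].
  rewrite S1 // ?R1 // ?F1 // ?m3 ?D1 ?m1 // !inE ?negb_or ?q1 ?q2 ?q3 //.
rewrite /length_inv Nm; split.
- by move=> p pn; rewrite keep ?HW //; lia.
- by move=> p pB; rewrite S1 // R2.
- move=> p pN; rewrite S1 //; last by lia.
  by rewrite R1 //; [rewrite F1 // ?m3; [apply: D3 | lia] | lia].
- move=> p q pN qN; rewrite !S1 //; try lia.
  rewrite !R1 //; try lia. rewrite !F1 //; try lia. rewrite m3; exact: D4.
- move=> d /andP[d0]; rewrite leq_eqVlt => /orP[/eqP->|dm] i x ix xd.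
    rewrite S2; try (rewrite /N; lia).
    split=> [[p [q [ip pq qx pi]]]|[p [q [ip pq qx [pi qi] sf]]]].
      have pN : p < N by rewrite /N; lia.
      have qN : q < N by rewrite /N; lia.
      move/(refines_eq R3 pN qN) => [ce le]; exists p, q; split=> //.
        by split=> //; rewrite -pi le.
      by apply/(D4 p q pN qN); rewrite -m3.
    have pN : p < N by rewrite /N; lia.
    have qN : q < N by rewrite /N; lia.
    exists p, q; split=> //; apply/(refines_eq R3 pN qN); split; last by rewrite pi qi.
    by rewrite m3; apply/(D4 p q pN qN).
  have := HT d; rewrite d0 -ltnS dm => /(_ isT) /(_ i x ix xd) <-.
  by rewrite keep //; [lia | rewrite !inE; lia | lia].
Qed.

(** The invariant between queries. The clear HD row belongs to it because a query with long blocks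
    runs [refine]; the word itself is gone, its first two cells being overwritten by the
    parameters. *)
Definition structure (d : nat) (mm : seq nat) : Prop :=
  [/\ size mm = Q * B, cell B mm 0 0 = n /\ cell B mm 0 1 = d,
      clear_row rowHD mm,
      small_row rowID (n - d + 1) mm /\
      (forall p q, p < n - d + 1 -> q < n - d + 1 ->
         (cell B mm rowID p = cell B mm rowID q <-> same_factor w d p q)) &
      forall e, 0 < e <= d -> repeat_table e mm].

Lemma buildP r : size w = n -> 0 < r <= n -> Q = n %/ r + 8 ->
  runs W (build c) (start [:: n; r] (w ++ nseq (Q * B - n) 0))
    (30 + (n %/ r * (c.+1 * (n * 1100 + 150) + n * 1300 + 158) + 6) + (n * 40 + 6) + 30)
    (fun s' => structure (n %/ r) (mem s')).
Proof.
move=> wn_size /andP[r0 rn_] Qd; set d := n %/ r in Qd *.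
have d0 : 0 < d by rewrite divn_gt0.
have dn : d <= n by apply: leq_div.
have nB : n <= Q * B by nia.
set m0 := w ++ _.
have szm0 : size m0 = Q * B by rewrite size_cat size_nseq wn_size; lia.
apply: (@runs_leq _ _ _ (30 + ((d * (c.+1 * (n * 1100 + 150) + n * 1300 + 158) + 6) +
    ((n * 40 + 6) + 30)))); last by lia.
apply: (@runs_wp_seq _ _ _ _ _ _ (fun s1 => s1 =
    upd (upd (upd (upd (start [:: n; r] m0) rn n) rs d) rB (n + 2)) rcb c.+1)) => //.
  by step; step; step; step.
move=> s1 s1E.
(* The clause on [rN] keeps the number of positions of the last turn, n - d + 1, over which row CL
   is then copied to row ID. *)
pose I m s' := length_inv m (mem s') /\ (0 < m -> regs s' rN = n - m.-1).
have h1 : runs W (For rm rs length_step) s1 (d * (c.+1 * (n * 1100 + 150) + n * 1300 + 158) + 6)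
    (fun s' => [/\ size (mem s') = size (mem s1),
      forall y, y \notin rm :: assigned length_step -> regs s' y = regs s1 y & I d s']).
  apply: runs_leq (@runs_for _ _ _ _ (c.+1 * (n * 1100 + 150) + n * 1300 + 150)
    d I _ _ _ _ _ _ _ _ _) _ => //.
  - by lia.
  - by rewrite s1E.
  - rewrite s1E; split=> //.
    (* Below the word the memory is still zero: HD is clear, and all positions share the name 0, as
       befits the empty factor. *)
    have z q x : x < B -> 0 < q -> cell B m0 q x = 0.
      by move=> xB q0; rewrite /cell nth_cat ifN ?nth_nseq ?if_same // wn_size; nia.
    split=> //.
    + by move=> p pn; rewrite /cell nth_cat mul0n add0n wn_size pn.
    + by move=> p pB; apply: z.
    + by move=> p pN; rewrite z //; lia.
    + by move=> p q pN qN; rewrite !z //; lia.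
    + by move=> e; lia.
  - move=> u s' ud sz fr s'm [Iu _].
    apply: runs_weaken (@length_stepP s' u _ _ _ _ _ _ _ _) _ _ => //;
      rewrite ?fr ?sz ?s1E //; try lia.
    by move=> s'' [s''N Iu']; split.
  - by lia.
apply: runs_seq h1 _ => s2 [sz2 fr2 [[HW HH HC HN HT] /(_ d0) s2N]].
have Nd : n - d.-1 = n - d + 1 by lia.
rewrite Nd in s2N.
have s2B : regs s2 rB = B by rewrite fr2 // s1E Bn.
have s2n : regs s2 rn = n by rewrite fr2 // s1E.
have s2s : regs s2 rs = d by rewrite fr2 // s1E.
have szs2 : size (mem s2) = Q * B by rewrite sz2 s1E.
have NB : n - d + 1 <= B by lia.
have h3 := @copyP _ _ _ QBW Q8 B3 s2 _ rowCL rowID s2B s2N szs2 NB isT isT isT.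
apply: (@runs_seq _ _ _ _ _ _ _ _ (runs_weaken (runs_frame h3) _ (fun _ => id))).
  by lia.
move=> s3 [sz3 fr3 [C1 C2]].
have s3B : regs s3 rB = B by rewrite fr3.
have s3n : regs s3 rn = n by rewrite fr3.
have s3s : regs s3 rs = d by rewrite fr3.
have szs3 : size (mem s3) = Q * B by rewrite sz3.
apply: (@runs_wp _ _ _ _ (fun s' => structure d (mem s'))) => //.
step. step. split.
- sz.
- by split; cells.
- by move=> p pB; cells; rewrite C1 // HH.
- split=> [p pN|p q pN qN]; cells; rewrite !C2 //; [exact: HC | exact: HN].
- move=> e ed i x ix xe; cells.
  by rewrite C1; [apply: HT | lia | lia].
Qed.

End Build.

(** * Queries *)

Lemma nth_flatten_blocks (T : Type) d (ys : seq (seq T)) a :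
  all (fun y => size y == d) ys -> a < size ys ->
  nth [::] ys a = take d (drop (a * d) (flatten ys)).
Proof.
elim: ys a => // y ys IH [|a] /= /andP[/eqP yd ysd]; first by rewrite drop0 -yd take_size_cat.
rewrite ltnS => /(IH _ ysd) ->.
by rewrite mulSn addnC -drop_drop drop_size_cat.
Qed.

(** Blocks of a common length are determined by that length, which must be the quotient by [k]; the
    existential over decompositions becomes a condition on positions. *)
Lemma antipower_factors w i j k : i <= j < size w -> 2 <= k ->
  let d := (j.+1 - i) %/ k in
  antipower k (fragment w i j) <->
  k %| j.+1 - i /\
  forall a b, a < b < k -> ~ same_factor w d (i + a * d) (i + b * d).
Proof.
move=> /andP[ij jw] k2 d; set x := fragment w i j.
have szx : size x = j.+1 - i by rewrite size_take size_drop; case: ltnP; lia.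
have k0 : 0 < k by apply: leq_trans k2.
have sf ys : size ys = k -> all (fun y : seq nat => size y == d) ys -> x = flatten ys ->
    size x = k * d ->
    forall a b, a < k -> b < k ->
    (nth [::] ys a = nth [::] ys b <-> same_factor w d (i + a * d) (i + b * d)).
  move=> szys ysd xE xd a b ak bk.
  have nthE e y : e < k -> y < d -> nth 0 (nth [::] ys e) y = nth 0 w (i + e * d + y).
    move=> ek yd; rewrite (nth_flatten_blocks ysd) ?szys // -xE nth_take // nth_drop.
    rewrite nth_take ?nth_drop ?addnA //; rewrite -szx xd.
    by apply: (@leq_trans (e.+1 * d)); [rewrite mulSn addnC ltn_add2r | rewrite leq_mul2r ek orbT].
  have szE e : e < k -> size (nth [::] ys e) = d.
    by move=> ek; apply/eqP/(allP ysd); rewrite mem_nth ?szys.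
  split=> [e y yd|h]; first by rewrite -!nthE // e.
  apply: (@eq_from_nth _ 0); first by rewrite !szE.
  by move=> y; rewrite szE // => yd; rewrite !nthE // h.
split.
  case=> _ [ys [szys xE [d' ysd'] uys]].
  have {}ysd' : all (fun y => size y == d') ys by apply/allP => y /ysd' ->.
  have xd' : size x = k * d'.
    rewrite xE size_flatten -szys; elim: ys ysd' {szys xE uys} => //= y ys IH /andP[/eqP-> /IH ->].
    by rewrite mulSn.
  have dd' : d = d' by rewrite /d -szx xd' mulKn.
  rewrite -dd' in ysd' xd'.
  split; first by rewrite -szx xd' dvdn_mulr.
  move=> a b /andP[ab bk] /(sf _ szys ysd' xE xd' a b (ltn_trans ab bk) bk)/eqP.
  by rewrite nth_uniq ?szys //; lia.
case=> kd inj; split=> //.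
have xd : size x = k * d by rewrite szx mulnC divnK.
pose ys := reshape (nseq k d) x.
have shys : shape ys = nseq k d by rewrite reshapeKl // sumn_nseq xd mulnC.
have szys : size ys = k by rewrite -(size_map size) -/(shape ys) shys size_nseq.
have ysd : all (fun y => size y == d) ys.
  by have := all_pred1_nseq d k; rewrite -shys all_map.
have xE : x = flatten ys by rewrite reshapeKr // sumn_nseq xd mulnC.
exists ys; split=> //; first by exists d => y /(allP ysd)/eqP.
apply/(uniqP [::]) => a b; rewrite !inE szys => ak bk /(sf _ szys ysd xE xd a b ak bk) h.
case: (ltngtP a b) => // ab.
  by case: (inj a b); rewrite ?ab.
case: (inj b a); rewrite ?ab // => y yd; by rewrite h.
Qed.

(** A window may overlap the part already compared. This lets the last one be shifted back so as to
    end with the block. *)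
Lemma same_factor_window w m s o p q : o <= m <= o + s ->
  same_factor w (o + s) p q <-> same_factor w m p q /\ same_factor w s (p + o) (q + o).
Proof.
move=> /andP[om mos]; split=> [h|[h1 h2] x xos].
  by split=> x xm; [apply: h; lia | rewrite -!addnA; apply: h; lia].
case: (ltnP x m) => [|mx]; first exact: h1.
have := h2 (x - o); rewrite -!addnA subnKC; last by lia.
by apply; lia.
Qed.

Definition window_step : cmd :=
  (ro ::= Reg ru *' Reg rs ;;
   If (Reg rd -' Reg rs <' Reg ro) (ro ::= Reg rd -' Reg rs) Skip ;;
   rbase ::= Reg 0 +' Reg ro) ;;
  fill rowLT (At (Const rowID) (Reg rbase +' Reg rp *' Reg rd)) ;;
  refine ;;
  fill rowCL (At (Const rowNW) (Reg rp)).

(* The blocks are distinct iff each one represents its own class. *)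
Definition long_query : cmd :=
  rN ::= Reg 2 ;;
  fill rowCL (Const 0) ;;
  rcnt ::= (Reg rd +' Reg rs -' Const 1) /' Reg rs ;;
  For ru rcnt window_step ;;
  0 ::= Const 1 ;;
  For rp rN (If (At (Const rowCL) (Reg rp) ==' Reg rp) Skip (0 ::= Const 0)).

Definition query : cmd :=
  (rn ::= Cell (Const 0) ;; rs ::= Cell (Const 1) ;; rB ::= Reg rn +' Const 2 ;;
   rl ::= Reg 1 +' Const 1 -' Reg 0) ;;
  If (Reg rl %' Reg 2) (0 ::= Const 0)
    (rd ::= Reg rl /' Reg 2 ;;
     If (Reg rs <' Reg rd) long_query
       (0 ::= Reg 1 +' Const 1 -' Reg rd <' At rowE (Reg 0))).

Section Query.
Variables (W n B Q d : nat) (w : seq nat).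
Hypothesis QBW : Q * B < 2 ^ W.
Hypothesis Bn : B = n + 2.
Hypothesis d0 : 0 < d <= n.
Hypothesis Qd : Q = d + 8.

Let Q8 : 8 < Q.
Proof. by lia. Qed.

Let B3 : 2 < B.
Proof. by lia. Qed.

Let BW : Q + B * 4 < 2 ^ W.
Proof. by apply: leq_ltn_trans QBW; nia. Qed.

Let W0 : 0 < W.
Proof. by case: W QBW => //; nia. Qed.

(** Here [d] is the window length, held in [rs], and [l] the block length, held in [rd]. After [u]
    windows the classes express equality of the prefixes of length [minn (u * d) l] of the
    blocks. *)
Lemma windowsP s i k l cnt :
  regs s rB = B -> regs s rN = k -> regs s rs = d -> regs s rd = l -> regs s 0 = i ->
  regs s rcnt = cnt -> size (mem s) = Q * B ->
  2 <= k -> d < l -> i + k * l <= n -> cnt = (l + d - 1) %/ d ->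
  structure n B Q w d (mem s) -> (forall a, a < k -> cell B (mem s) rowCL a = 0) ->
  runs W (For ru rcnt window_step) s (cnt * (k * 1200 + 200) + 6)
    (fun s' => [/\ outside B scratch (mem s) (mem s'), clear_row B rowHD (mem s'),
      forall a b, a < k -> b < k ->
        (cell B (mem s') rowCL a = cell B (mem s') rowCL b <->
         same_factor w l (i + a * l) (i + b * l)) &
      forall a, a < k -> let f := cell B (mem s') rowCL a in f < k /\ cell B (mem s') rowCL f = f]).
Proof.
move=> sB sN ss sd s0 scnt szs k2 dl ikl cntE [_ _ HH [IDB ID] _] C0.
pose I u s' := [/\ outside B scratch (mem s) (mem s'), clear_row B rowHD (mem s'),
  forall a, a < k -> cell B (mem s') rowCL a < B,
  forall a b, a < k -> b < k ->
    (cell B (mem s') rowCL a = cell B (mem s') rowCL b <->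
     same_factor w (minn (u * d) l) (i + a * l) (i + b * l)) &
  0 < u -> forall a, a < k ->
    let f := cell B (mem s') rowCL a in f < k /\ cell B (mem s') rowCL f = f].
have kB : k < B by nia.
have cntl : l <= cnt * d.
  have := ltn_ceil (l + d - 1) (proj1 (andP d0)); rewrite -cntE mulSn; lia.
have cntu u : u < cnt -> u * d < l.
  move=> uc; have : cnt * d <= l + d - 1 by rewrite cntE leq_divM.
  have : u.+1 * d <= cnt * d by rewrite leq_mul2r uc orbT.
  by rewrite mulSn; lia.
have cnt0 : 0 < cnt by case: cnt cntl {cntu cntE scnt}; lia.
have cntn : cnt <= l + d by rewrite cntE; apply: leq_trans (leq_div _ _) _; lia.
have ll : l * 2 <= k * l by rewrite mulnC leq_mul2r k2 orbT.
apply: runs_weaken (@runs_for _ _ _ _ (k * 1200 + 190) cnt I _ _ _ _ _ _ _ _ _) _ _ => //.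
- by lia.
- split=> //; first by move=> a ak; rewrite C0 //; lia.
  by move=> a b ak bk; rewrite !C0 // mul0n min0n.
- move=> u s' uc sz fr s'u [I1 I2 I3 I4 _].
  have s'B : regs s' rB = B by rewrite fr.
  have s'N : regs s' rN = k by rewrite fr.
  have s's : regs s' rs = d by rewrite fr.
  have s'd : regs s' rd = l by rewrite fr.
  have s'0 : regs s' 0 = i by rewrite fr.
  have sz' : size (mem s') = Q * B by rewrite sz.
  have ud := cntu u uc.
  pose o := minn (u * d) (l - d).
  apply: (@runs_leq _ _ _ (40 + ((k * 50 + 6) + ((k * 1000 + 100) + (k * 40 + 6)))));
      last by lia.
  apply: runs_seq (runs_frame (@runs_wp _ _ _ 40
    (fun s1 => mem s1 = mem s' /\ regs s1 rbase = i + o) _ _)) _ => //.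
    step. step => c1; step; step; split=> //; rewrite upd_eq /o;
      case: (ltnP (l - d) (u * d)) c1 => // h _; lia.
  move=> s1 [sz1 fr1 [m1 s1b]].
  have s1B : regs s1 rB = B by rewrite fr1.
  have s1N : regs s1 rN = k by rewrite fr1.
  have szs1 : size (mem s1) = Q * B by rewrite sz1.
  have posE a : a < k -> i + o + a * l + d <= n.
    move=> ak; have : a.+1 * l <= k * l by rewrite leq_mul2r ak orbT.
    by rewrite mulSn /o; lia.
  pose f a := cell B (mem s) rowID (i + o + a * l).
  have h1 : runs W (fill rowLT (At (Const rowID) (Reg rbase +' Reg rp *' Reg rd))) s1 (k * 50 + 6)
    (fun s2 => (forall q x, x < B -> q != rowLT -> cell B (mem s2) q x = cell B (mem s1) q x) /\
               (forall a, a < k -> cell B (mem s2) rowLT a = f a)).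
    apply: runs_weaken (@fillP _ _ _ QBW Q8 B3 _ _ _ _
      f s1B s1N szs1 (ltnW kB) _ _) _ _ => //;
      last by rewrite /=; lia.
    move=> a s2 ak s2p fr2 sz2 M2.
    have s2B : regs s2 rB = B by rewrite fr2.
    have s2d : regs s2 rd = l by rewrite fr2 // fr1.
    have s2b : regs s2 rbase = i + o by rewrite fr2.
    have pa := posE a ak.
    have -> : f a = cell B (mem s2) rowID (i + o + a * l).
      by rewrite M2 ?m1 ?I1 //; lia.
    by ev.
  apply: runs_seq (runs_frame h1) _ => s2 [sz2 fr2 [M1 M2]].
  have s2B : regs s2 rB = B by rewrite fr2.
  have s2N : regs s2 rN = k by rewrite fr2.
  have szs2 : size (mem s2) = Q * B by rewrite sz2.
  have h2 := @refineP _ _ _ QBW Q8 B3 s2 k (cell B (mem s') rowCL) f s2B s2N szs2 kB.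
  apply: runs_seq (runs_frame (h2 _ _ _)) _.
  - by move=> a ak; split; [apply: M2 | apply: IDB; have := posE a ak; lia].
  - by move=> a ak; split; [rewrite M1 ?m1 //; lia | apply: I3].
  - by move=> a aB; rewrite M1 // m1 I2.
  move=> s3 [sz3 fr3 [R1 R2 R3]].
  have s3B : regs s3 rB = B by rewrite fr3.
  have s3N : regs s3 rN = k by rewrite fr3.
  have szs3 : size (mem s3) = Q * B by rewrite sz3.
  have h3 := @copyP _ _ _ QBW Q8 B3 s3 k rowNW rowCL s3B s3N szs3 (ltnW kB) isT isT isT.
  apply: runs_weaken (runs_frame h3) _ _ => //.
  move=> s4 [sz4 fr4 [T1 T2]].
  split=> [q x xB qr|p pB|a ak|a b ak bk|_ a ak]; rewrite !mem_upd.
  + move: (qr); rewrite !inE !negb_or => /and5P[q1 q2 q3 q4 /andP[q5 q6]].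
    by rewrite T1 // R1 ?M1 ?m1 ?I1 // !inE !negb_or q1 q2 q3.
  + by rewrite T1 // R2.
  + by rewrite T2 //; have [nk _ _] := R3.1 a ak; lia.
  + rewrite !T2 // (refines_eq R3 ak bk) I4 // /f.
    have -> : minn (u.+1 * d) l = o + d by rewrite mulSn /o; lia.
    rewrite (@same_factor_window w (minn (u * d) l) d o) ?(minn_idPl (ltnW ud));
      last by rewrite /o; lia.
    have pa := posE a ak; have pb := posE b bk.
    rewrite ID; [|lia|lia].
    by rewrite -!addnA ![o + _]addnC; tauto.
  + have [nk c1 c2] := R3.1 a ak.
    by rewrite /= !T2 //; split=> //; exact: (R3.2 _ _ nk ak c1 c2).
- by lia.
- move=> s' [_ _ [I1 I2 _ I4 I5]]; split=> //; last exact: I5.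
  by move=> a b ak bk; rewrite I4 // (minn_idPr cntl).
Qed.

Lemma structure_outside m1 m2 : outside B scratch m1 m2 -> clear_row B rowHD m2 ->
  size m2 = size m1 -> structure n B Q w d m1 -> structure n B Q w d m2.
Proof.
move=> out HH sz [szm [m00 m01] _ [IDB ID] HT].
have out0 x : x < B -> cell B m2 0 x = cell B m1 0 x by move=> xB; apply: out.
have out1 x : x < B -> cell B m2 1 x = cell B m1 1 x by move=> xB; apply: out.
split=> //; rewrite ?sz ?out0 //; try lia.
  split=> [p pN|p q pN qN]; rewrite !out1; try lia; [exact: IDB | exact: ID].
move=> e ed i x ix xe; rewrite out; [exact: HT | lia | rewrite !inE; lia].
Qed.

Lemma long_queryP s i k l :
  regs s rB = B -> regs s 2 = k -> regs s rs = d -> regs s rd = l -> regs s 0 = i ->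
  size (mem s) = Q * B ->
  2 <= k -> d < l -> i + k * l <= n -> structure n B Q w d (mem s) ->
  runs W long_query s (k * 100 + (l + d - 1) %/ d * (k * 1200 + 200) + 100)
    (fun s' => structure n B Q w d (mem s') /\
      (regs s' 0 <> 0 <-> forall a b, a < b < k -> ~ same_factor w l (i + a * l) (i + b * l))).
Proof.
move=> sB s2 ss sd s0 szs k2 dl ikl st.
set cnt := (l + d - 1) %/ d.
have kB : k < B by nia.
have ll : l * 2 <= k * l by rewrite mulnC leq_mul2r k2 orbT.
apply: (@runs_leq _ _ _ (10 + ((k * 30 + 6) +
    (10 + ((cnt * (k * 1200 + 200) + 6) + (10 + (k * 40 + 6))))))); last by lia.
apply: (@runs_wp_seq _ _ _ _ _ _ (fun s1 => s1 = upd s rN k)) => //.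
  by step.
move=> s1 s1E.
have s1B : regs s1 rB = B by rewrite s1E.
have s1N : regs s1 rN = k by rewrite s1E.
have szs1 : size (mem s1) = Q * B by rewrite s1E.
have h1 : runs W (fill rowCL (Const 0)) s1 (k * 30 + 6)
  (fun s' => (forall q x, x < B -> q != rowCL -> cell B (mem s') q x = cell B (mem s1) q x) /\
             (forall p, p < k -> cell B (mem s') rowCL p = 0)).
  apply: runs_weaken (@fillP _ _ _ QBW Q8 B3 _ _ _ _
    (fun=> 0) s1B s1N szs1 (ltnW kB) _ _) _ _ => //;
    last by rewrite /=; lia.
  by move=> p s' *; ev.
apply: runs_seq (runs_frame h1) _ => s3 [sz3 fr3 [F1 F2]].
have s3d : regs s3 rd = l by rewrite fr3 // s1E.
have s3s : regs s3 rs = d by rewrite fr3 // s1E.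
apply: (@runs_wp_seq _ _ _ _ _ _ (fun s4 => s4 = upd s3 rcnt cnt)) => //.
  by step.
move=> s4 s4E.
have st4 : structure n B Q w d (mem s4).
  rewrite s4E; apply: (@structure_outside (mem s)) => //; last by rewrite sz3 s1E.
    by move=> q x xB; rewrite !inE !negb_or => /and5P[q1 q2 q3 q4 _]; rewrite F1 // s1E.
  by move=> p pB; rewrite F1 // s1E; case: st => _ _ ->.
have s4r y : y \notin [:: rp; rcnt; rN] -> regs s4 y = regs s y.
  rewrite !inE !negb_or => /and3P[/negbTE y1 /negbTE y2 /negbTE y3].
  by rewrite s4E upd_ne // fr3 ?inE ?y1 // s1E upd_ne.
have s4N : regs s4 rN = k by rewrite s4E upd_ne // fr3 // s1E.
have s4c : regs s4 rcnt = cnt by rewrite s4E upd_eq.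
have szs4 : size (mem s4) = Q * B by case: st4.
have h2 := @windowsP s4 i k l cnt.
apply: runs_seq (runs_frame (h2 _ _ _ _ _ _ _ _ _ _ _ _ _)) _ => //; rewrite ?s4r //.
  by move=> a ak; rewrite s4E F2.
move=> s5 [sz5 fr5 [O1 O2 O3 O4]].
have st5 : structure n B Q w d (mem s5) by apply: structure_outside st4.
have s5N : regs s5 rN = k by rewrite fr5 // s4E upd_ne // fr3 // s1E.
have s5B : regs s5 rB = B by rewrite fr5 // s4E upd_ne // fr3 // s1E.
apply: (@runs_wp_seq _ _ _ _ _ _ (fun s6 => s6 = upd s5 0 1)) => //.
  by step.
move=> s6 s6E.
pose I u s' := mem s' = mem s5 /\
  (regs s' 0 <> 0 <-> forall a, a < u -> cell B (mem s5) rowCL a = a).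
have szs5 : size (mem s5) = Q * B by case: st5.
apply: runs_weaken (@runs_for _ _ _ _ 30 k I _ _ _ _ _ _ _ _ _) _ _ => //.
- by lia.
- by rewrite s6E.
- by rewrite s6E; split.
- move=> u s' uk sz fr s'u [m' I'].
  have s'B : regs s' rB = B by rewrite fr // s6E.
  have sz' : size (mem s') = Q * B by rewrite m'.
  apply: (@runs_wp _ _ _ _ (fun s'' => I u.+1 (upd s'' rp u.+1))); last by [].
  step; rewrite m' => c1; step; split=> //; rewrite ?mem_upd //.
    rewrite upd_ne // I'; split=> [h a|h a au]; last by apply: h; lia.
    rewrite ltnS leq_eqVlt => /orP[/eqP->|]; last exact: h.
    by case: eqP c1.
  split; first by rewrite upd_ne // upd_eq.
  by move=> /(_ u (ltnSn u)) h; rewrite h eqxx in c1.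
- lia.
move=> s7 [_ _ [m7 I7]]; rewrite m7; split=> //; rewrite I7; split=> [h a b /andP[ab bk] sf|h a ak].
  have := (O3 a b (ltn_trans ab bk) bk).2 sf; rewrite h ?h //; lia.
(* A block other than its representative would agree with it, a block of different index. *)
have [fk ff] := O4 a ak; set f := cell _ _ _ a in fk ff *.
have sf := (O3 f a fk ak).1 ff.
case: (ltngtP f a) => // fa.
  by case: (h f a); rewrite ?fa.
by case: (h a f); rewrite ?fa // => y yl; rewrite sf.
Qed.

Lemma queryP m0 i j k r : size w = n -> structure n B Q w d m0 ->
  i <= j < n -> 2 <= k < 2 ^ W -> 0 < r -> n < d.+1 * r ->
  runs W query (start [:: i; j; k] m0) (100 * 100 * r)
    (fun s' => structure n B Q w d (mem s') /\
      (regs s' 0 <> 0 <-> antipower k (fragment w i j))).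
Proof.
move=> wn st /andP[ij jn] /andP[k2 kW] r0 nr.
have [szm [m00 m01] HH HID HT] := st.
set l := (j.+1 - i) %/ k.
have k0 : 0 < k by apply: leq_trans k2.
have ap := @antipower_factors w i j k; rewrite wn ij jn in ap.
have {}ap := ap isT k2; rewrite -/l in ap.
have QB0 : 1 < Q * B by nia.
apply: (@runs_leq _ _ _ (50 + (3 + (50 + (3 + 61 * 100 * r).+1)).+1));
    last by lia.
set s0 := start _ _.
apply: (@runs_wp_seq _ _ _ _ _ _ (fun s1 => s1 =
    upd (upd (upd (upd s0 rn n) rs d) rB (n + 2)) rl (j + 1 - i))) => //.
  have cell0 s : mem s = m0 -> eval W s (Cell (Const 0)) = Some n.
    by move=> sm; rewrite eval_cell (@ev_const W s 0) ?sm ?szm ?(ltnW QB0) -?m00 //; lia.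
  have cell1 s : mem s = m0 -> eval W s (Cell (Const 1)) = Some d.
    by move=> sm; rewrite eval_cell (@ev_const W s 1) ?sm ?szm ?QB0 -?m01 //; lia.
  apply: wp_seq; apply: wp_set; first exact: cell0.
  apply: wp_seq; apply: wp_set; first exact: cell1.
  have s00 : regs s0 0 = i by [].
  have s01 : regs s0 1 = j by [].
  by step; step.
move=> s1 s1E; have m1 : mem s1 = m0 by rewrite s1E.
have s10 : regs s1 0 = i by rewrite s1E.
have s11 : regs s1 1 = j by rewrite s1E.
have s12 : regs s1 2 = k by rewrite s1E.
have s1l : regs s1 rl = j.+1 - i by rewrite s1E upd_eq addn1.
have s1s : regs s1 rs = d by rewrite s1E.
have s1B : regs s1 rB = B by rewrite s1E Bn.
have ev1 : eval W s1 (Reg rl %' Reg 2) = Some ((j.+1 - i) %% k) by ev.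
(* A [k] exceeding the length of the fragment is rejected here too, since the fragment is
   nonempty. *)
apply: runs_if ev1 _; case: eqP => [kl|kl] /=; last first.
  apply: (@runs_wp _ _ _ _ (fun s' => structure n B Q w d (mem s') /\
      (regs s' 0 <> 0 <-> antipower k (fragment w i j)))); last by rewrite /=; lia.
  step; split; first by rewrite mem_upd m1.
  by rewrite upd_eq ap /dvdn; split=> // -[/eqP].
have {}kl : k %| j.+1 - i by apply/eqP.
have lk : k * l = j.+1 - i by rewrite mulnC divnK.
have l0 : 0 < l by rewrite lt0n; apply/eqP => l_0; move: lk; rewrite l_0 muln0; lia.
apply: (@runs_wp_seq _ _ _ _ _ _ (fun s2 => s2 = upd s1 rd l)) => //.
  by step.
move=> s2 s2E; have m2 : mem s2 = m0 by rewrite s2E.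
have s2d : regs s2 rd = l by rewrite s2E upd_eq.
have s2s : regs s2 rs = d by rewrite s2E upd_ne.
have s2B : regs s2 rB = B by rewrite s2E upd_ne.
have s20 : regs s2 0 = i by rewrite s2E upd_ne.
have s21 : regs s2 1 = j by rewrite s2E upd_ne.
have sz2 : size (mem s2) = Q * B by rewrite m2.
have ln : l <= n by have := leq_pmull l k0; lia.
have ev2 : eval W s2 (Reg rs <' Reg rd) = Some (d < l : nat) by ev.
apply: runs_if ev2 _; case: ltnP => [dl|ld] /=.
  have h := @long_queryP s2 i k l.
  apply: runs_weaken (h _ _ _ _ _ _ _ _ _ _) _ _ => //;
    rewrite ?s2E ?upd_ne ?mem_upd ?m1 //; try lia.
    set cnt := _ %/ d.
    have cd : cnt * d <= l + d - 1 by apply: leq_divM.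
    have cnt0 : 0 < cnt by rewrite divn_gt0; lia.
    (* From d < l, cnt d <= 2 l; hence cnt k d <= 2 l k <= 2 n <= 4 d r, and d cancels. *)
    have : cnt * k <= 4 * r.
      rewrite -(@leq_pmul2r d); last by lia.
      have h1 : cnt * d * k <= 2 * l * k by rewrite leq_mul2r; apply/orP; right; lia.
      have h2 : 2 * l * k <= 2 * n by rewrite -mulnA leq_mul2l /= mulnC lk; lia.
      have h3 : n <= 2 * (d * r).
        by have : r <= d * r; [apply: leq_pmull; case/andP: d0 | rewrite mulSn in nr; lia].
      by rewrite mulnAC; lia.
    have : k <= cnt * k by apply: leq_pmull.
    have : cnt <= cnt * k by apply: leq_pmulr.
    by rewrite mulnDr mulnA; lia.
  move=> s' [st' res]; split=> //; rewrite res ap.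
  by split=> [|[]].
apply: (@runs_wp _ _ _ _ (fun s' => structure n B Q w d (mem s') /\
      (regs s' 0 <> 0 <-> antipower k (fragment w i j)))); last by rewrite /=; lia.
have lj : l <= j + 1 by have := leq_pmull l k0; lia.
have kl1 : k * l = (k.-1) * l + l by rewrite -{1}(prednK k0) mulSn addnC.
step; split; first by rewrite mem_upd m2.
rewrite upd_eq ap m2.
have -> : j + 1 - l = i + k.-1 * l by lia.
set x := i + k.-1 * l.
have xl : x + l <= n by rewrite /x; lia.
have ld' : 0 < l <= d by rewrite l0.
have [rep1 rep2] := HT l ld' i x (leq_addr _ _) xl.
have le_last b : b < k -> b * l <= k.-1 * l by move=> bk; rewrite leq_mul2r; lia.
case: ltnP => [xE|Ex]; split=> //.
  move=> _; split=> // a b /andP[ab bk] sf.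
  have : cell B m0 (7 + l) i <= x; last by lia.
  apply: rep2; exists (i + a * l), (i + b * l); split=> //.
  - exact: leq_addr.
  - by rewrite ltn_add2l ltn_pmul2r.
  - by rewrite leq_add2l le_last.
  - by rewrite ![i + _]addnC !modnMDl.
case=> _ distinct; have [p [q [ip pq qx [pi qi] sf]]] := rep1 Ex.
(* Positions congruent to [i] are block starts, and the quotients are the block indices. *)
have mult y : i <= y -> y = i %[mod l] -> y = i + (y - i) %/ l * l.
  by move=> iy yi; rewrite divnK ?subnKC // -eqn_mod_dvd //; apply/eqP.
have pE := mult p ip pi; have qE := mult q (ltnW (leq_ltn_trans ip pq)) qi.
case: (distinct ((p - i) %/ l) ((q - i) %/ l)); last by rewrite -pE -qE.
rewrite -(ltn_pmul2r l0) -(ltn_add2l i) -pE -qE pq /=.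
rewrite -(ltn_pmul2r l0) -(ltn_add2l i) -qE (leq_ltn_trans qx) // ltn_add2l kl1.
by rewrite -[X in X < _]addn0 ltn_add2l.
Qed.

End Query.

(** * Sequences of queries and the final bounds *)

Lemma answers_structure W n B Q d w r qs m0 :
  Q * B < 2 ^ W -> B = n + 2 -> 0 < d <= n -> Q = d + 8 -> size w = n ->
  0 < r -> n < d.+1 * r -> structure n B Q w d m0 -> all (valid_query W n) qs ->
  answers W (100 * 100 * r) query w m0 qs.
Proof.
move=> QBW Bn d0 Qd wn r0 nr; elim: qs m0 => //= -[[i j] k] qs IH m0 st /andP[].
move=> /and3P[ij jn kW] vqs.
have [|s [t [ex tT [st' res]]]] := queryP QBW Bn d0 Qd wn st (i := i) (j := j) _ kW r0 nr.
  by rewrite ij.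
by exists s, t; split=> //; apply: IH.
Qed.

Theorem theorem3 (c : nat) :
  exists (build query : cmd) (C : nat),
  forall (W n r : nat) (w : seq nat),
    size w = n ->
    (forall a, a \in w -> 1 <= a <= n ^ c) ->
    1 <= r <= n ->
    C * (trunc_log 2 n).+1 <= W ->
    exists M Tbuild Tquery : nat,
      [/\ antipower_data_structure W build query w r M Tbuild Tquery,
          M * r <= C * n ^ 2,
          Tbuild * r <= C * n ^ 2 &
          Tquery <= C * r].
Proof.
(* The factor [c.+2] pays for the [c.+1] digit refinements per length and makes words wide enough
   for [n.+1 ^ c.+1]. *)
exists (build c), query, (100 * 100 * c.+2) => W n r w wn wc /andP[r0 rn_] CW.
set L := (trunc_log 2 n).+1 in CW.
have nL : n < 2 ^ L by apply: trunc_log_ltn.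
have L0 : 0 < L by [].
set d := n %/ r; set B := n + 2; set Q := d + 8.
have d0 : 0 < d by rewrite divn_gt0.
have dn : d <= n by apply: leq_div.
have n0 : 0 < n by apply: leq_trans rn_.
have dr : d * r <= n by apply: leq_divM.
have nr : n < d.+1 * r by apply: ltn_ceil.
have Q8 : 8 < Q by rewrite /Q; lia.
have c2W : c.+2 * L <= W by apply: leq_trans CW; rewrite leq_mul2r; lia.
have L7 : 7 * L <= W by apply: leq_trans CW; rewrite leq_mul2r; lia.
(* d + 8 <= 9 d and n + 2 <= 3 n, as d and n are positive. *)
have QB : Q * B <= 27 * (n * d).
  have -> : 27 * (n * d) = (9 * d) * (3 * n) by lia.
  by apply: leq_mul; rewrite /Q /B; lia.
(* 27 n d lies below 32 times the square of 2^L, which is at most 2^(7 L). *)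
have QBW : Q * B < 2 ^ W.
  apply: leq_trans (leq_pexp2l (isT : 0 < 2) L7); apply: leq_ltn_trans QB _.
  have nd : n * d < 2 ^ L * 2 ^ L.
    by apply: leq_ltn_trans (_ : n * n < _); rewrite ?leq_mul2l ?dn ?orbT // ltn_mul.
  have e32 : 32 <= 2 ^ (5 * L) by rewrite (@leq_exp2l 2 5) // leq_pmulr.
  apply: (@leq_trans (32 * (2 ^ L * 2 ^ L))).
    by move: nd; move: (2 ^ L * 2 ^ L) (n * d) => x y; lia.
  apply: leq_trans (leq_mul e32 (leqnn _)) _.
  by rewrite -!expnD leq_exp2l //; lia.
have cW : c.+1 < 2 ^ W.
  apply: (@leq_trans (2 ^ c.+1)); first exact: ltn_expl.
  by rewrite leq_exp2l // (leq_trans _ c2W) // (leq_trans (leqnSn _)) // leq_pmulr.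
have ncW : n.+1 ^ c.+1 < 2 ^ W.
  apply: (@leq_ltn_trans ((2 ^ L) ^ c.+1)); first by rewrite leq_exp2r.
  by rewrite -expnM ltn_exp2l //; apply: leq_trans c2W; rewrite mulnC ltn_mul2r L0 ltnSn.
have wn' p : p < n -> nth 0 w p < n.+1 ^ c.+1.
  move=> pn; have /andP[_ le] := wc _ (mem_nth 0 (etrans (congr1 (leq p.+1) wn) pn)).
  apply: leq_ltn_trans le _; apply: (@leq_ltn_trans (n.+1 ^ c)).
    by case: (c) => [//|e]; rewrite leq_exp2r.
  by rewrite ltn_exp2l.
have [s [t [ex tT st]]] := @buildP W n B Q c w QBW Q8 n0 erefl cW ncW wn' r wn
  (introT andP (conj r0 rn_)) erefl.
exists (Q * B), (30 + (d * (c.+1 * (n * 1100 + 150) + n * 1300 + 158) + 6) + (n * 40 + 6) + 30),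
  (100 * 100 * r); split.
- split; first by rewrite wn; apply: leq_trans (_ : 1 * B <= _); rewrite ?leq_mul2r /B; lia.
  exists s, t; rewrite wn; split=> // qs vqs.
  by apply: answers_structure st vqs; rewrite ?d0.
- apply: (@leq_trans (27 * (n * d) * r)); first by rewrite leq_mul2r QB orbT.
  rewrite -mulnA; apply: leq_mul; first by lia.
  by rewrite -mulnA -mulnn leq_mul2l dr orbT.
(* All terms are absorbed into z = d (c + 1) n, and z r <= (c + 1) n^2. The coefficients are sums:
   2708 = 1100 + 150 + 1300 + 158, and 2820 adds 30 + 6 + 40 + 6 + 30. *)
- set y := c.+1 * n; set z := d * y.
  have cy : c.+1 <= y by apply: leq_pmulr.
  have ny : n <= y by apply: leq_pmull.
  have yz : y <= z by apply: leq_pmull.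
  have step_le : c.+1 * (n * 1100 + 150) + n * 1300 + 158 <= y * 2708.
    by rewrite mulnDr mulnA -/y; lia.
  have build_le : d * (c.+1 * (n * 1100 + 150) + n * 1300 + 158) <= z * 2708.
    by rewrite /z -mulnA leq_mul2l step_le orbT.
  apply: (@leq_trans (z * 2820 * r)); first by rewrite leq_mul2r; apply/orP; right; lia.
  have zr : z * r <= c.+1 * (n * n).
    have -> : z * r = c.+1 * (n * (d * r)) by rewrite /z /y mulnCA -!mulnA (mulnCA d).
    by rewrite !leq_mul2l dr !orbT.
  rewrite mulnAC -mulnn; apply: leq_trans (leq_mul zr (leqnn _)) _.
  rewrite mulnAC leq_mul2r; apply/orP; right.
  by lia.
- by rewrite leq_mul2r leq_pmulr ?orbT.
Qed.
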